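(* Let $\Pi_{\mathsf{1UTE}}$ be an untelegraphable secret-key encryption scheme with message space $\{\mathcal{M}_\lambda\}_{\lambda\in\mathbb{N}}$ and key space $\{\mathcal{K}_\lambda\}_{\lambda\in\mathbb{N}}$, let $\Pi_{\mathsf{NCE}}$ be a secret-key non-committing encryption scheme for receiver (SK-NCER) with message space $\{\mathcal{K}_\lambda\}_{\lambda\in\mathbb{N}}$, and let $\Pi_{\mathsf{UTE}}$ be the untelegraphable encryption scheme built from them by the hybrid construction (defined in the context). Suppose $\Pi_{\mathsf{1UTE}}$ satisfies indistinguishability security and $\Pi_{\mathsf{NCE}}$ satisfies non-committing security for QPT adversaries. Then $\Pi_{\mathsf{UTE}}$ satisfies collusion-resistant security.
   Context: $\lambda$ is the security parameter; QPT means quantum polynomial time; $\mathrm{negl}$ denotes a negligible function. Untelegraphable secret-key encryption (UTE). A tuple of QPT algorithms $(\mathsf{Gen},\mathsf{Enc},\mathsf{Dec})$: $\mathsf{Gen}(1^\lambda)$ outputs a classical key $\mathsf{sk}$; $\mathsf{Enc}(\mathsf{sk},m)$ outputs a quantum ciphertext $|\mathsf{ct}\rangle$; $\mathsf{Dec}(\mathsf{sk},|\mathsf{ct}\rangle)$ outputs a message; decryption of an honest encryption of any $m$ is correct with probability $1-\mathrm{negl}(\lambda)$. In a variant with separate keys, $\mathsf{Gen}$ outputs $(\mathsf{ek},\mathsf{dk})$, $\mathsf{Enc}$ uses $\mathsf{ek}$, $\mathsf{Dec}$ uses $\mathsf{dk}$, and only $\mathsf{dk}$ is revealed to the second-stage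 adversary. Indistinguishability security (game with bit $b$, two-stage adversary $(\mathcal{A},\mathcal{B})$): $\mathcal{A}$ outputs $m_0,m_1$; the challenger samples the key(s) and gives an encryption of $m_b$ to $\mathcal{A}$; $\mathcal{A}$ outputs a classical string $\mathsf{st}$; $\mathcal{B}$ receives $\mathsf{st}$ and the secret (decryption) key and outputs a bit $b_{\mathcal{B}}$. Security: for all QPT $(\mathcal{A},\mathcal{B})$, $|\Pr[b_{\mathcal{B}}=1\mid b=0]-\Pr[b_{\mathcal{B}}=1\mid b=1]|=\mathrm{negl}(\lambda)$. Collusion-resistant security: same as indistinguishability security, except that $\mathcal{A}$ may adaptively make (polynomially) many queries $(m_0^{(i)},m_1^{(i)})$, receiving each time a fresh encryption of $m_b^{(i)}$ under the same key, before outputting $\mathsf{st}$. SK-NCER. A tuple of efficient algorithms $(\mathsf{KG},\mathsf{Enc},\mathsf{Dec},\mathsf{Fake},\mathsf{Reveal})$: $\mathsf{KG}(1^\lambda)\to(\mathsf{ek},\mathsf{dk})$; $\mathsf{Enc}(\mathsf{ek},m)\to\mathsf{ct}$; $\mathsf{Dec}(\mathsf{dk},\mathsf{ct})\to m$; $\mathsf{Fake}(\mathsf{ek})\to(\mathsf{ct},\mathsf{st})$; $\mathsf{Reveal}(\mathsf{st},m^* )\to\mathsf{dk}^*$; with $\Pr[\mathsf{Dec}(\mathsf{dk},\mathsf{Enc}(\mathsf{ek},m))=m]\ge1-\mathrm{negl}(\lambda)$ for every $m$. Non-committing security game with bit $b$: the challenger samples $(\mathsf{ek},\mathsf{dk})\leftarrow\mathsf{KG}(1^\lambda)$;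 the adversary makes, in any order, arbitrarily many encryption queries $m$ (answered by $\mathsf{Enc}(\mathsf{ek},m)$) and one challenge query $m^*$, answered by $(\mathsf{ct}^*,\mathsf{dk}^* )$, where if $b=0$, $\mathsf{ct}^*\leftarrow\mathsf{Enc}(\mathsf{ek},m^* )$ and $\mathsf{dk}^*=\mathsf{dk}$, and if $b=1$, $(\mathsf{ct}^*,\mathsf{st})\leftarrow\mathsf{Fake}(\mathsf{ek})$ and $\mathsf{dk}^*\leftarrow\mathsf{Reveal}(\mathsf{st},m^* )$; the adversary outputs a bit $b'$. Security for QPT adversaries: $|\Pr[b'=1\mid b=0]-\Pr[b'=1\mid b=1]|=\mathrm{negl}(\lambda)$ for every QPT adversary. Hybrid construction of $\Pi_{\mathsf{UTE}}$ (message space $\{\mathcal{M}_\lambda\}$, separate keys). - $\mathsf{Gen}(1^\lambda)$: output $(\mathsf{ek},\mathsf{dk})\leftarrow\mathsf{NCE.KG}(1^\lambda)$. - $\mathsf{Enc}(\mathsf{ek},m)$: sample $\mathsf{sk}_{\mathsf{1UTE}}\leftarrow\mathsf{1UTE.Gen}(1^\lambda)$; output $(\mathsf{1UTE.Enc}(\mathsf{sk}_{\mathsf{1UTE}},m),\ \mathsf{NCE.Enc}(\mathsf{ek},\mathsf{sk}_{\mathsf{1UTE}}))$. - $\mathsf{Dec}(\mathsf{dk},(|\mathsf{ct}_1\rangle,\mathsf{ct}_2))$: output $\mathsf{1UTE.Dec}(\mathsf{NCE.Dec}(\mathsf{dk},\mathsf{ct}_2),|\mathsf{ct}_1\rangle)$.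 *)

(* Defs.v *)
From HB Require Import structures.
From mathcomp Require Import all_boot all_order all_algebra all_field.
From mathcomp Require Import finmap.

Set Implicit Arguments.
Unset Strict Implicit.
Unset Printing Implicit Defensive.

Import Order.TTheory GRing.Theory Num.Theory.
Local Open Scope ring_scope.

Definition bits := seq bool.

(* Finite formal sums of weighted points.  Over classical points the weights
   are probabilities; over the machine configurations below, they are the
   coefficients of a density operator. *)
Definition dist (X : Type) := seq (algC * X).

Definition ret (X : Type) (x : X) : dist X := [:: (1, x)].

Definition bind (X Y : Type) (d : dist X) (f : X -> dist Y) : dist Y :=
  flatten [seq [seq (p.1 * q.1, q.2) | q <- f p.2] | p <- d].

Notation "x <~ d ; e" := (bind d (fun x => e))
  (at level 61, d at next level, right associativity).
Notation "' p <~ d ; e" := (bind d (fun x => let: p := x in e))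
  (at level 61, p strict pattern, d at next level, right associativity).

Definition Pr (X : Type) (d : dist X) (E : pred X) : algC :=
  \sum_(p <- d | E p.2) p.1.

Definition negligible (f : nat -> algC) : Prop :=
  forall c : nat, exists n0 : nat,
    forall n : nat, (n0 <= n)%N -> `|f n| < (n%:R ^+ c)^-1.

(** Machines *)

Definition regs := {fsfun nat -> bits with [::]}.

Definition upd (r : regs) (i : nat) (v : bits) : regs := [fsfun r with i |-> v].

Definition load (xs : seq bits) : regs :=
  foldl (fun r p => upd r p.1 p.2) [fsfun] (zip (iota 0 (size xs)) xs).

Definition store (zs : seq nat) (ys : seq bits) (r : regs) : regs :=
  foldl (fun r p => upd r p.1 p.2) r (zip zs ys).

(* A machine has classical registers, which are stacks of bits, and quantum
   registers, which are stacks of qubits.  A value of type mem stands for the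
   operator |kt><br| on the quantum registers together with the contents cl of
   the classical ones; a (mixed) state of the machine is a dist mem, and an
   operation is given by its action on the operators |kt><br|. *)
Record mem := Mem { cl : regs; kt : regs; br : regs }.

(* Strings together with an operator |x><y| on one quantum register. *)
Definition cq : Type := (seq bits * (bits * bits))%type.

Definition cq0 (xs : seq bits) : cq := (xs, ([::], [::])).

Definition set_cl (m : mem) (r : regs) := Mem r (kt m) (br m).

Definition init (x : cq) : mem :=
  Mem (load x.1) (upd [fsfun] 0 x.2.1) (upd [fsfun] 0 x.2.2).

Definition takeq (q : option nat) (m : mem) : (bits * bits) * mem :=
  if q is Some i
  then ((kt m i, br m i), Mem (cl m) (upd (kt m) i [::]) (upd (br m) i [::]))
  else (([::], [::]), m).

(* The test for equality of the ket and the bra is a partial trace: the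
   previous contents of register i, or the value itself if it is not wanted,
   are discarded. *)
Definition putq (q : option nat) (v : bits * bits) (m : mem) : dist mem :=
  if q is Some i then
    if kt m i == br m i
    then ret (Mem (cl m) (upd (kt m) i v.1) (upd (br m) i v.2)) else [::]
  else if v.1 == v.2 then ret m else [::].

(* The strings in the classical registers 0, ..., k-1 and the quantum
   register 0; all other quantum registers are traced out. *)
Definition outputs (k : nat) (m : mem) : dist cq :=
  if upd (kt m) 0 [::] == upd (br m) 0 [::]
  then ret ([seq cl m i | i <- iota 0 k], (kt m 0%N, br m 0%N)) else [::].

Definition discard_q (x : cq) : dist (seq bits) :=
  if x.2.1 == x.2.2 then ret x.1 else [::].

(* Isometries: gates act on the top qubits of registers, QNew pushes |0> and
   QMove moves the top qubit of one register to the top of another one.  The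
   gate set {H, T, CNOT} is universal. *)
Inductive qop :=
| QNew of nat
| QMove of nat & nat
| GateH of nat
| GateT of nat
| GateCNOT of nat & nat.

Definition qact (g : qop) (r : regs) : dist regs :=
  match g with
  | QNew i => ret (upd r i (false :: r i))
  | QMove i j =>
      if r i is b :: s then
        let r' := upd r i s in ret (upd r' j (b :: r' j))
      else ret r
  | GateH i =>
      if r i is b :: s then
        [:: ((sqrtC 2)^-1, upd r i (false :: s));
            ((-1) ^+ b / sqrtC 2, upd r i (true :: s))]
      else ret r
  | GateT i =>
      if r i is b :: s then [:: (((1 + 'i) / sqrtC 2) ^+ b, r)] else ret r
  | GateCNOT i j =>
      if i == j then ret r else
      match r i, r j with
      | b :: _, b' :: s => ret (upd r j (b (+) b' :: s))
      | _, _ => ret r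
      end
  end.

(* QPT algorithms.  All loops are repetitions Rep, executed n times when the
   security parameter is n; nesting d of them gives n ^ d iterations, so a
   program always stops after polynomially many elementary steps, and every
   polynomially clocked (quantum) Turing machine, having its tapes held in
   stacks, can be simulated.  A program does not depend on n, hence the model is
   uniform.  An elementary step lengthens the longest register by at most one
   symbol, up to data supplied by an oracle.

   Ask k xs zs q sends the strings in the registers xs to the k-th oracle and
   stores its answer in the classical registers zs and in the quantum register
   q.  Call f xs qi zs qo runs f on a fresh memory as a subroutine without
   oracle access, with the strings in xs copied to its registers 0, 1, ... and
   the quantum register qi moved to its quantum register 0, and stores its
   outputs in zs and qo. *)
Inductive cmd :=
| Skip
| Seq of cmd & cmd
| Rep of cmd
| Case of nat & cmd & cmd & cmd  (* top of the register: none, 0, 1 *)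
| Push of bool & nat
| Pop of nat
| Copy of nat & nat              (* Copy x y overwrites y by x *)
| Quantum of qop
| Measure of nat & nat           (* pops a qubit, pushes the outcome *)
| Ask of nat & seq nat & seq nat & option nat
| Call of cmd & seq nat & option nat & seq nat & option nat.

Notation "c1 ;; c2" := (Seq c1 c2) (at level 65, right associativity).

(* A challenger with private classical state S: it answers a query of strings
   by strings and a quantum register, not entangled with anything it keeps. *)
Definition oracle (S : Type) := nat -> seq bits -> S -> dist (S * cq).

Definition no_oracle : oracle unit := fun _ _ s => ret (s, cq0 [::]).

Fixpoint run (S : Type) (O : oracle S) (n : nat) (c : cmd) (s : S) (m : mem) :
    dist (S * mem) :=
  match c with
  | Skip => ret (s, m)
  | Seq c1 c2 => '(s1, m1) <~ run O n c1 s m; run O n c2 s1 m1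
  | Rep c1 =>
      iter n (fun d => '(s1, m1) <~ d; run O n c1 s1 m1) (ret (s, m))
  | Case x c0 c1 c2 =>
      match cl m x with
      | [::] => run O n c0 s m
      | false :: _ => run O n c1 s m
      | true :: _ => run O n c2 s m
      end
  | Push b x => ret (s, set_cl m (upd (cl m) x (b :: cl m x)))
  | Pop x => ret (s, set_cl m (upd (cl m) x (behead (cl m x))))
  | Copy x y => ret (s, set_cl m (upd (cl m) y (cl m x)))
  | Quantum g =>
      [seq (u.1 * (v.1)^*, (s, Mem (cl m) u.2 v.2))
         | u <- qact g (kt m), v <- qact g (br m)]
  | Measure i x =>
      match kt m i, br m i with
      | b :: u, b' :: v =>
          if b == b'
          then ret (s, Mem (upd (cl m) x (b :: cl m x))
                           (upd (kt m) i u) (upd (br m) i v))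
          else [::]
      | _, _ => ret (s, m)
      end
  | Ask k xs zs q =>
      '(s1, a) <~ O k [seq cl m x | x <- xs] s;
      m1 <~ putq q a.2 (set_cl m (store zs a.1 (cl m)));
      ret (s1, m1)
  | Call f xs qi zs qo =>
      let: (v, m1) := takeq qi m in
      '(_, m2) <~ run no_oracle n f tt (init ([seq cl m x | x <- xs], v));
      a <~ outputs (size zs) m2;
      m3 <~ putq qo a.2 (set_cl m1 (store zs a.1 (cl m1)));
      ret (s, m3)
  end.

(* Run of an algorithm with k output strings and a quantum output. *)
Definition qexec (f : cmd) (n k : nat) (x : cq) : dist cq :=
  '(_, m) <~ run no_oracle n f tt (init x); outputs k m.

(* The same with classical inputs and outputs only. *)
Definition exec (f : cmd) (n k : nat) (xs : seq bits) : dist (seq bits) :=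
  x <~ qexec f n k (cq0 xs); discard_q x.

Definition fst_of (xs : seq bits) : bits := nth [::] xs 0.
Definition snd_of (xs : seq bits) : bits := nth [::] xs 1.

Definition unary (n : nat) : bits := nseq n true.

(** Oracle adversaries *)

(* Run of an adversary on input 1^n, with k output strings. *)
Definition exec_adv (S : Type) (O : oracle S) (s0 : S) (A : cmd) (n k : nat) :
    dist (S * seq bits) :=
  '(s, m) <~ run O n A s0 (init (cq0 [:: unary n]));
  x <~ outputs k m; ys <~ discard_q x; ret (s, ys).

Definition monitor (S : Type) (L : pred (seq bits)) (O : oracle S) :
    oracle (S * bool) :=
  fun k xs s => '(s1, a) <~ O k xs s.1; ret ((s1, s.2 && L xs), a).

(* The number of qubits sent by an oracle is not in superposition. *)
Definition well_formed (S : Type) (O : oracle S) : Prop :=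
  forall k xs s, all (fun p => size p.2.2.2.1 == size p.2.2.2.2) (O k xs s).

(* The adversary only makes queries satisfying L, whatever it is answered. *)
Definition legal (L : nat -> pred (seq bits)) (A : cmd) : Prop :=
  forall (S : Type) (O : oracle S) (s0 : S) (n : nat), well_formed O ->
    Pr (exec_adv (monitor (L n) O) (s0, true) A n 0) (fun r => ~~ r.1.2) = 0.

(** Untelegraphable encryption *)

(* A ciphertext consists of a quantum register and of ute_nct classical
   strings. *)
Record ute := Ute {
  ute_gen : cmd;
  ute_enc : cmd;
  ute_dec : cmd;
  ute_nct : nat }.

(* The pair (encryption key, decryption key), either for a scheme with a single
   key sk or for one with separate keys. *)
Definition keying := ute -> nat -> dist (bits * bits).

Definition single_key : keying := fun P n =>
  ks <~ exec (ute_gen P) n 1 [:: unary n]; ret (fst_of ks, fst_of ks).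

Definition separate_keys : keying := fun P n =>
  ks <~ exec (ute_gen P) n 2 [:: unary n]; ret (fst_of ks, snd_of ks).

Definition ute_encrypt (P : ute) (n : nat) (ek m : bits) : dist cq :=
  qexec (ute_enc P) n (ute_nct P) (cq0 [:: ek; m]).

Definition ute_decrypt (P : ute) (n : nat) (dk : bits) (ct : cq) : dist bits :=
  x <~ qexec (ute_dec P) n 1 (dk :: ct.1, ct.2);
  ms <~ discard_q x; ret (fst_of ms).

Definition ute_correct (G : keying) (P : ute) (M : nat -> pred bits) : Prop :=
  exists2 eps : nat -> algC, negligible eps &
    forall (n : nat) (m : bits), M n m ->
      1 - eps n <= Pr ('(ek, dk) <~ G P n; ct <~ ute_encrypt P n ek m;
                       ute_decrypt P n dk ct)
                      (fun m' => m' == m).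

Definition key_space (P : ute) (K : nat -> pred bits) : Prop :=
  forall (n : nat) (k : bits), ~~ K n k ->
    Pr (exec (ute_gen P) n 1 [:: unary n]) (fun ks => fst_of ks == k) = 0.

(* The first stage outputs a tuple st of adv_nst strings. *)
Record ute_adv := UteAdv {
  adv_A : cmd;
  adv_B : cmd;
  adv_nst : nat }.

(* The state counts the queries; at most q of them are answered if the limit
   is Some q. *)
Definition ute_challenger (P : ute) (limit : option nat) (n : nat) (ek : bits)
    (b : bool) : oracle nat := fun _ ms i =>
  if (if limit is Some q then (i < q)%N else true) then
    ct <~ ute_encrypt P n ek (if b then snd_of ms else fst_of ms);
    ret (i.+1, ct)
  else ret (i, cq0 [::]).

Definition ute_game (G : keying) (P : ute) (limit : option nat) (D : ute_adv)
    (n : nat) (b : bool) : dist bits :=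
  '(ek, dk) <~ G P n;
  '(_, st) <~ exec_adv (ute_challenger P limit n ek b) 0%N (adv_A D) n
                       (adv_nst D);
  out <~ exec (adv_B D) n 1 (dk :: st);
  ret (fst_of out).

Definition advantage (game : nat -> bool -> dist bits) (n : nat) : algC :=
  `| Pr (game n false) (pred1 [:: true]) - Pr (game n true) (pred1 [:: true]) |.

Definition message_pair (M : nat -> pred bits) (n : nat) : pred (seq bits) :=
  fun ms => (size ms == 2) && all (M n) ms.

Definition ind_secure (G : keying) (P : ute) (M : nat -> pred bits) : Prop :=
  forall D : ute_adv, legal (message_pair M) (adv_A D) ->
    negligible (advantage (ute_game G P (Some 1%N) D)).

Definition collusion_secure (G : keying) (P : ute) (M : nat -> pred bits) :
    Prop :=
  forall D : ute_adv, legal (message_pair M) (adv_A D) ->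
    negligible (advantage (ute_game G P None D)).

(** Secret-key non-committing encryption for receiver *)

Record ncer := Ncer {
  nce_kg : cmd;
  nce_enc : cmd;
  nce_dec : cmd;
  nce_fake : cmd;
  nce_reveal : cmd }.

Definition ncer_keys (N : ncer) (n : nat) : dist (bits * bits) :=
  ks <~ exec (nce_kg N) n 2 [:: unary n]; ret (fst_of ks, snd_of ks).

Definition ncer_encrypt (N : ncer) (n : nat) (ek m : bits) : dist bits :=
  xs <~ exec (nce_enc N) n 1 [:: ek; m]; ret (fst_of xs).

Definition ncer_decrypt (N : ncer) (n : nat) (dk ct : bits) : dist bits :=
  xs <~ exec (nce_dec N) n 1 [:: dk; ct]; ret (fst_of xs).

Definition ncer_fake (N : ncer) (n : nat) (ek : bits) : dist (bits * bits) :=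
  xs <~ exec (nce_fake N) n 2 [:: ek]; ret (fst_of xs, snd_of xs).

Definition ncer_reveal (N : ncer) (n : nat) (st m : bits) : dist bits :=
  xs <~ exec (nce_reveal N) n 1 [:: st; m]; ret (fst_of xs).

Definition ncer_correct (N : ncer) (K : nat -> pred bits) : Prop :=
  exists2 eps : nat -> algC, negligible eps &
    forall (n : nat) (m : bits), K n m ->
      1 - eps n <= Pr ('(ek, dk) <~ ncer_keys N n; ct <~ ncer_encrypt N n ek m;
                       ncer_decrypt N n dk ct)
                      (fun m' => m' == m).

(* Oracle 0 encrypts; any other one is the challenge oracle, which answers
   only once (the state tells whether it already did). *)
Definition nc_challenger (N : ncer) (n : nat) (ek dk : bits) (b : bool) :
    oracle bool := fun k ms used =>
  let m := fst_of ms in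
  if k == 0%N then
    ct <~ ncer_encrypt N n ek m; ret (used, cq0 [:: ct])
  else if used then ret (used, cq0 [::])
  else if b then
    '(ct, st) <~ ncer_fake N n ek;
    dk' <~ ncer_reveal N n st m;
    ret (true, cq0 [:: ct; dk'])
  else
    ct <~ ncer_encrypt N n ek m; ret (true, cq0 [:: ct; dk]).

Definition nc_game (N : ncer) (A : cmd) (n : nat) (b : bool) : dist bits :=
  '(ek, dk) <~ ncer_keys N n;
  '(_, out) <~ exec_adv (nc_challenger N n ek dk b) false A n 1;
  ret (fst_of out).

Definition single_message (K : nat -> pred bits) (n : nat) : pred (seq bits) :=
  fun ms => (size ms == 1) && all (K n) ms.

Definition nc_secure (N : ncer) (K : nat -> pred bits) : Prop :=
  forall A : cmd, legal (single_message K) A -> negligible (advantage (nc_game N A)).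

(** Hybrid construction *)

(* The ciphertext (ct1, ct2) has as classical strings ct2 followed by those of
   ct1, and as quantum register that of ct1. *)
Definition hybrid_enc (P : ute) (N : ncer) : cmd :=
  let sk := (ute_nct P).+2 in
  let one := sk.+1 in
  Rep (Push true one) ;;
  Call (ute_gen P) [:: one] None [:: sk] None ;;
  Call (ute_enc P) [:: sk; 1]%N None (iota 1 (ute_nct P)) (Some 0%N) ;;
  Call (nce_enc N) [:: 0; sk]%N None [:: 0]%N None.

Definition hybrid_dec (P : ute) (N : ncer) : cmd :=
  Call (nce_dec N) [:: 0; 1]%N None [:: 0]%N None ;;
  Call (ute_dec P) (0%N :: iota 2 (ute_nct P)) (Some 0%N) [:: 0]%N None.

Definition hybrid (P : ute) (N : ncer) : ute :=
  Ute (nce_kg N) (hybrid_enc P N) (hybrid_dec P N) (ute_nct P).+1.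

(* Main.v *)
(* The i-th hybrid answers the first i queries with the second message and the
   others with the first one. Two consecutive hybrids differ in a single query:
   there, sampling the one-time key and its encryption already at the beginning
   and then replacing this encryption and the decryption key by Fake and Reveal
   changes little by non-committing security; now the one-time key is used, up
   to the last stage, only for that query, so that one-time security allows to
   exchange the two messages. As the number of queries is only polynomially
   bounded, the reductions choose i at random in a range [0, w), and the
   advantages telescope up to a factor w; coins being the only source of
   randomness, w is a power of two.

   Everything is linear in the formal sums: no step uses the positivity of their
   weights, and equality of sums is replaced by that of expectations. *)

Require Import Defs.
From mathcomp Require Import all_boot all_order all_algebra all_field.
From mathcomp Require Import finmap zify.
Import Defs.

Set Implicit Arguments.
Unset Strict Implicit.
Unset Printing Implicit Defensive.

Import Order.TTheory GRing.Theory Num.Theory.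
Local Open Scope ring_scope.

(** * Expectations *)

(** One-time security becomes applicable because [nce_reveal] needs the one-time key while
    [nce_fake] does not: the first stage of the reduction runs [nce_fake] and hands its state to the
    second one, which is given the key and computes the simulated decryption key.

    All comparisons of games are instances of one simulation principle, in which a state of one
    oracle stands for a signed mixture of states of another. A proper mixture lets the planted key
    be sampled early or late, the empty mixture expresses that an expectation vanishes, and a
    difference of two points isolates the runs with an illegal planted query.

    The last two serve legality. The reductions must be legal against every well-formed oracle,
    whose weights are arbitrary numbers: a total weight 0 does not make single terms vanish, and an
    event cannot be bounded by a larger one. *)

Definition Ex (X : Type) (d : dist X) (f : X -> algC) : algC :=
  \sum_(p <- d) p.1 * f p.2.

Lemma Ex_nil (X : Type) (f : X -> algC) : Ex [::] f = 0.
Proof. by rewrite /Ex big_nil. Qed.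

Lemma Ex_cons (X : Type) p (d : dist X) f : Ex (p :: d) f = p.1 * f p.2 + Ex d f.
Proof. by rewrite /Ex big_cons. Qed.

Lemma Ex_ret (X : Type) (x : X) f : Ex (ret x) f = f x.
Proof. by rewrite /Ex big_seq1 mul1r. Qed.

Lemma eq_Ex (X : Type) (d : dist X) f g : f =1 g -> Ex d f = Ex d g.
Proof. by move=> fg; apply: eq_bigr => p _; rewrite fg. Qed.

Lemma Ex_bind (X Y : Type) (d : dist X) (h : X -> dist Y) f :
  Ex (bind d h) f = Ex d (fun x => Ex (h x) f).
Proof.
rewrite /Ex big_flatten big_map; apply: eq_bigr => p _.
by rewrite big_map mulr_sumr; apply: eq_bigr => q _; rewrite mulrA.
Qed.

Lemma Ex_swap (X Y : Type) (d : dist X) (e : dist Y) f :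
  Ex d (fun x => Ex e (f x)) = Ex e (fun y => Ex d (f^~ y)).
Proof.
rewrite /Ex; under eq_bigr do rewrite mulr_sumr.
rewrite exchange_big /=; apply: eq_bigr => q _; rewrite mulr_sumr.
by apply: eq_bigr => p _; rewrite mulrCA.
Qed.

Lemma Ex0 (X : Type) (d : dist X) f : (forall x, f x = 0) -> Ex d f = 0.
Proof. by move=> f0; rewrite /Ex big1 // => p _; rewrite f0 mulr0. Qed.

Lemma ExMl (X : Type) (d : dist X) c f : Ex d (fun x => c * f x) = c * Ex d f.
Proof. by rewrite /Ex mulr_sumr; apply: eq_bigr => p _; rewrite mulrCA. Qed.

Lemma Ex_cst (X : Type) (d : dist X) c :
  Ex d (fun=> 1) = 1 -> Ex d (fun=> c) = c.
Proof. by move=> d1; have := ExMl d c (fun=> 1); rewrite d1 !mulr1. Qed.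

Lemma ExB (X : Type) (d : dist X) f g :
  Ex d (fun x => f x - g x) = Ex d f - Ex d g.
Proof. by rewrite /Ex -sumrB; apply: eq_bigr => p _; rewrite mulrBr. Qed.

Lemma Ex_if (X : Type) (b : bool) (d : dist X) f :
  Ex (if b then d else [::]) f = b%:R * Ex d f.
Proof. by case: b; rewrite ?mul1r // mul0r Ex_nil. Qed.

Lemma PrE (X : Type) (d : dist X) (E : pred X) : Pr d E = Ex d (fun x => (E x)%:R).
Proof.
rewrite /Pr /Ex big_mkcond; apply: eq_bigr => p _.
by case: ifP => _; rewrite ?mulr1 ?mulr0.
Qed.

(* Points of total weight 0 do not contribute, even though the formal sum may
   list them. *)
Lemma Ex_supp (X : eqType) (d : dist X) (L : pred X) f :
    (forall x, ~~ L x -> Pr d (pred1 x) = 0) -> (forall x, L x -> f x = 0) ->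
  Ex d f = 0.
Proof.
move=> d0 f0; pose s := undup [seq p.2 | p <- d].
rewrite /Ex (eq_big_seq (fun p => \sum_(x <- s) (p.2 == x)%:R * (p.1 * f x))).
  rewrite exchange_big big1_seq // => x _ /=.
  have [/f0 -> | /d0] := boolP (L x); first by rewrite big1 // => p _; rewrite !mulr0.
  rewrite PrE /Ex /= => dx0; transitivity (0 * f x); last by rewrite mul0r.
  by rewrite -[in RHS]dx0 mulr_suml; apply: eq_bigr => p _; rewrite mulrA [_%:R * _]mulrC.
move=> p p_d; rewrite (bigD1_seq p.2) /= ?undup_uniq ?mem_undup ?map_f //.
rewrite eqxx mul1r big1 ?addr0 // => x /negPf.
by rewrite eq_sym => ->; rewrite mul0r.
Qed.

Lemma bind_ret (X Y : Type) (x : X) (h : X -> dist Y) : bind (ret x) h = h x.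
Proof.
rewrite /bind /= cats0; elim: (h x) => //= -[c y] d ->.
by rewrite mul1r.
Qed.

(** * Registers *)

Lemma updE (r : regs) i v j : upd r i v j = if j == i then v else r j.
Proof. by rewrite /upd fsfun_withE. Qed.

Lemma upd_id (r : regs) i v : r i = v -> upd r i v = r.
Proof. by move=> <-; apply/fsfunP => j; rewrite updE; case: eqP => [->|]. Qed.

Lemma upd_upd (r : regs) i v w : upd (upd r i v) i w = upd r i w.
Proof. by apply/fsfunP => j; rewrite !updE; case: eqP. Qed.

(** The trace tests whether ket and bra agree on all registers; this isolates the test on the one
    register that a command touches. *)
Lemma upd_eq2 (k b : regs) i v w :
  (upd k i [::] == upd b i [::]) && (v == w) = (upd k i v == upd b i w).
Proof.
apply/andP/eqP => [[/eqP/fsfunP kb /eqP ->]|/fsfunP kb].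
  by apply/fsfunP => j; have := kb j; rewrite !updE; case: eqP.
have := kb i; rewrite !updE eqxx => ->; split=> //; apply/eqP/fsfunP => j.
by have := kb j; rewrite !updE; case: eqP.
Qed.

Lemma eq_regs_upd (k b : regs) i :
  (upd k i [::] == upd b i [::]) && (k i == b i) = (k == b).
Proof. by rewrite upd_eq2 !upd_id. Qed.

Lemma store_out (zs : seq nat) (ys : seq bits) (r : regs) x :
  x \notin zs -> store zs ys r x = r x.
Proof.
rewrite /store; elim: zs ys r => [|z zs IH] [|y ys] r //=.
by rewrite inE => /norP[/negPf x_z /IH ->]; rewrite updE x_z.
Qed.

Lemma store_iota a k (ys : seq bits) (r : regs) x :
  store (iota a k) ys r x =
    if (a <= x < a + minn k (size ys))%N then nth [::] ys (x - a) else r x.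
Proof.
rewrite /store; elim: ys a k r => [|y ys IH] a [|k] r /=;
  rewrite ?minn0 ?min0n ?addn0; try by case: ltngtP.
rewrite IH updE minnSS addnS addSn ltnS.
case: (ltngtP a x) => //= [lt_ax|->]; last by rewrite subnn leq_addr.
by case: leqP => // _; rewrite -(subnSK lt_ax).
Qed.

Lemma loadE (xs : seq bits) x : load xs x = nth [::] xs x.
Proof.
rewrite -[load xs]/(store (iota 0 (size xs)) xs [fsfun]) store_iota minnn subn0.
by rewrite add0n /=; case: ltnP => // /(nth_default [::]) ->; rewrite fsfunE.
Qed.

Lemma store_shift B (zs : seq nat) (ys : seq bits) (r' r : regs) :
    (forall x, r' (B + x)%N = r x) ->
  forall x, store (map (addn B) zs) ys r' (B + x)%N = store zs ys r x.
Proof.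
rewrite /store; elim: zs ys r' r => [|z zs IH] [|y ys] r' r //= r'r.
by apply: IH => x; rewrite !updE eqn_add2l r'r.
Qed.

Lemma store_scratch B (zs : seq nat) (ys : seq bits) (r : regs) x :
  (x < B)%N -> store (map (addn B) zs) ys r x = r x.
Proof.
move=> x_B; apply: store_out; apply/mapP => -[z _ xE].
by move: x_B; rewrite xE ltnNge leq_addr.
Qed.

(** * Expectations over runs *)

(** The quantitative weakest precondition of [p]: working backwards with functions turns equality of
    games into equality of numbers. *)
Definition wp (S : Type) (O : oracle S) n c (p : S -> mem -> algC) s m : algC :=
  Ex (run O n c s m) (fun x => p x.1 x.2).

(** In [Rep] the number of iterations is the security parameter. Here the two are separate, so that
    an induction on [t] leaves the body of the loop unchanged. *)
Definition wpn (S : Type) (O : oracle S) n c t (p : S -> mem -> algC) s m : algC :=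
  Ex (iter t (fun d => '(s1, m1) <~ d; run O n c s1 m1) (ret (s, m)))
     (fun x => p x.1 x.2).

Definition reps e c : cmd := iter e Rep c.

Section WP.
Context (S : Type) (O : oracle S) (n : nat).
Implicit Types (p : S -> mem -> algC) (s : S) (m : mem).

Lemma eq_wp c p q s m : (forall s1 m1, p s1 m1 = q s1 m1) ->
  wp O n c p s m = wp O n c q s m.
Proof. by move=> pq; apply: eq_Ex => -[s1 m1]; exact: pq. Qed.

Lemma wp_skip p s m : wp O n Skip p s m = p s m.
Proof. by rewrite /wp Ex_ret. Qed.

Lemma wp_seq c1 c2 p s m :
  wp O n (c1 ;; c2) p s m = wp O n c1 (wp O n c2 p) s m.
Proof. by rewrite /wp Ex_bind; apply: eq_Ex => -[s1 m1]. Qed.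

Lemma wpn0 c p s m : wpn O n c 0 p s m = p s m.
Proof. by rewrite /wpn Ex_ret. Qed.

(** [iter] adds iterations at the end, whereas a precondition peels off the first one; the two agree
    because the iteration is linear in the initial formal sum. *)
Lemma wpnS c t p s m : wpn O n c t.+1 p s m = wp O n c (wpn O n c t p) s m.
Proof.
rewrite /wpn iterSr bind_ret; set F := fun d => _.
have wpn_d d : Ex (iter t F d) (fun x => p x.1 x.2) =
    Ex d (fun x => Ex (iter t F (ret x)) (fun y => p y.1 y.2)).
  elim: t d => [|t IH] d; first by apply: eq_Ex => x; rewrite Ex_ret.
  rewrite iterSr IH /F Ex_bind; apply: eq_Ex => -[s1 m1].
  by rewrite -[iter t.+1 _ _]/(iter t.+1 F _) iterSr IH /F bind_ret.
by rewrite wpn_d /wp; apply: eq_Ex => -[s1 m1].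
Qed.

Lemma wp_rep c p s m : wp O n (Rep c) p s m = wpn O n c n p s m.
Proof. by []. Qed.

Lemma wpnD c t u p s m : wpn O n c (t + u) p s m = wpn O n c t (wpn O n c u p) s m.
Proof.
elim: t s m => [|t IH] s m; first by rewrite wpn0.
by rewrite addSn !wpnS; apply: eq_wp => s1 m1; exact: IH.
Qed.

Lemma eq_wpn c t p q s m : (forall s1 m1, p s1 m1 = q s1 m1) ->
  wpn O n c t p s m = wpn O n c t q s m.
Proof. by move=> pq; apply: eq_Ex => -[s1 m1]; exact: pq. Qed.

Lemma wpnM c c' k t p s m :
    (forall q s1 m1, wp O n c' q s1 m1 = wpn O n c k q s1 m1) ->
  wpn O n c' t p s m = wpn O n c (t * k) p s m.
Proof.
move=> cc'; elim: t s m => [|t IH] s m; first by rewrite !wpn0.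
by rewrite wpnS cc' mulSn wpnD; apply: eq_wpn => s1 m1; exact: IH.
Qed.

Lemma wp_reps e c p s m : wp O n (reps e c) p s m = wpn O n c (n ^ e) p s m.
Proof.
elim: e p s m => [|e IH] p s m.
  by rewrite wpnS; apply: eq_wp => s1 m1; rewrite wpn0.
by rewrite [LHS]wp_rep expnS; apply: wpnM => q s1 m1; exact: IH.
Qed.

Lemma wp_case x c0 c1 c2 p s m :
  wp O n (Case x c0 c1 c2) p s m =
    match cl m x with
    | [::] => wp O n c0 p s m
    | false :: _ => wp O n c1 p s m
    | true :: _ => wp O n c2 p s m
    end.
Proof. by rewrite /wp /=; case: (cl m x) => [|[]]. Qed.

Lemma wp_push b x p s m :
  wp O n (Push b x) p s m = p s (set_cl m (upd (cl m) x (b :: cl m x))).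
Proof. by rewrite /wp Ex_ret. Qed.

Lemma wp_pop x p s m :
  wp O n (Pop x) p s m = p s (set_cl m (upd (cl m) x (behead (cl m x)))).
Proof. by rewrite /wp Ex_ret. Qed.

Lemma wp_copy x y p s m :
  wp O n (Copy x y) p s m = p s (set_cl m (upd (cl m) y (cl m x))).
Proof. by rewrite /wp Ex_ret. Qed.

Lemma wp_quantum g p s m :
  wp O n (Quantum g) p s m =
    Ex (qact g (kt m)) (fun u => \sum_(v <- qact g (br m))
       v.1^* * p s (Mem (cl m) u v.2)).
Proof.
rewrite /wp /Ex /= big_flatten big_map; apply: eq_bigr => u _.
by rewrite big_map mulr_sumr; apply: eq_bigr => v _; rewrite mulrA.
Qed.

Lemma wp_ask k xs zs q p s m :
  wp O n (Ask k xs zs q) p s m =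
    Ex (O k [seq cl m x | x <- xs] s) (fun x =>
      Ex (putq q x.2.2 (set_cl m (store zs x.2.1 (cl m)))) (p x.1)).
Proof.
rewrite /wp /= Ex_bind; apply: eq_Ex => -[s1 a] /=.
by rewrite Ex_bind; apply: eq_Ex => m1; rewrite Ex_ret.
Qed.

Lemma wp_call f xs qi zs qo p s m :
  wp O n (Call f xs qi zs qo) p s m =
    Ex (qexec f n (size zs) ([seq cl m x | x <- xs], (takeq qi m).1)) (fun a =>
      Ex (putq qo a.2 (set_cl (takeq qi m).2 (store zs a.1 (cl (takeq qi m).2))))
         (p s)).
Proof.
rewrite /wp /=; case: (takeq qi m) => v m1 /=; rewrite /qexec !Ex_bind.
apply: eq_Ex => -[s2 m2] /=; rewrite Ex_bind; apply: eq_Ex => a.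
by rewrite Ex_bind; apply: eq_Ex => m3; rewrite Ex_ret.
Qed.

End WP.

(** The trace of the operator |kt><br|. It weights every final expectation, as quantum registers
    that are not output are traced out. *)
Definition tr (m : mem) : algC := (kt m == br m)%:R.

Lemma Ex_outputs k m f :
  Ex (outputs k m) f =
    (upd (kt m) 0 [::] == upd (br m) 0 [::])%:R *
    f ([seq cl m i | i <- iota 0 k], (kt m 0%N, br m 0%N)).
Proof. by rewrite /outputs Ex_if Ex_ret. Qed.

Lemma Ex_discard_q x f : Ex (discard_q x) f = (x.2.1 == x.2.2)%:R * f x.1.
Proof. by rewrite /discard_q Ex_if Ex_ret. Qed.

Lemma Ex_outputs_discard k m f :
  Ex (outputs k m) (fun x => Ex (discard_q x) f) =
    tr m * f [seq cl m i | i <- iota 0 k].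
Proof.
by rewrite Ex_outputs Ex_discard_q mulrA -natrM mulnb eq_regs_upd.
Qed.

Lemma Ex_qexec f n k x g :
  Ex (qexec f n k x) g =
    wp no_oracle n f (fun _ m => Ex (outputs k m) g) tt (init x).
Proof. by rewrite /qexec Ex_bind; apply: eq_Ex => -[[] m]. Qed.

Lemma Ex_exec f n k xs g :
  Ex (exec f n k xs) g =
    wp no_oracle n f (fun _ m => tr m * g [seq cl m i | i <- iota 0 k]) tt
       (init (cq0 xs)).
Proof.
rewrite /exec Ex_bind Ex_qexec; apply: eq_wp => _ m.
by rewrite Ex_outputs_discard.
Qed.

Lemma Ex_exec_adv (S : Type) (O : oracle S) s0 A n k g :
  Ex (exec_adv O s0 A n k) g =
    wp O n A (fun s m => tr m * g (s, [seq cl m i | i <- iota 0 k])) s0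
       (init (cq0 [:: unary n])).
Proof.
rewrite /exec_adv Ex_bind; apply: eq_Ex => -[s m] /=.
rewrite Ex_bind -(Ex_outputs_discard k m (fun ys => g (s, ys))).
by apply: eq_Ex => x; rewrite Ex_bind; apply: eq_Ex => ys; rewrite Ex_ret.
Qed.

Lemma Ex_putq q v m f :
  Ex (putq q v m) f =
    (if q is Some i then kt m i == br m i else v.1 == v.2)%:R *
    f (Mem (cl m) (if q is Some i then upd (kt m) i v.1 else kt m)
                  (if q is Some i then upd (br m) i v.2 else br m)).
Proof. by case: m => r k b; case: q => [i|] /=; rewrite Ex_if Ex_ret. Qed.

Lemma wp_call_cq (S : Type) (O : oracle S) n f xs zs qo p s m :
  wp O n (Call f xs None zs qo) p s m =
    Ex (qexec f n (size zs) (cq0 [seq cl m x | x <- xs])) (fun a =>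
      Ex (putq qo a.2 (set_cl m (store zs a.1 (cl m)))) (p s)).
Proof. exact: wp_call. Qed.

Lemma wp_call_c (S : Type) (O : oracle S) n f xs zs p s m :
  wp O n (Call f xs None zs None) p s m =
    Ex (exec f n (size zs) [seq cl m x | x <- xs]) (fun ys =>
      p s (set_cl m (store zs ys (cl m)))).
Proof.
rewrite wp_call_cq /exec Ex_bind; apply: eq_Ex => a.
by rewrite Ex_putq Ex_discard_q; case: m.
Qed.

(** * Balanced memories and preservation of the trace *)

Definition All (X : Type) (P : X -> Prop) (d : dist X) : Prop :=
  foldr (fun p Q => P p.2 /\ Q) True d.

Lemma All_cat (X : Type) (P : X -> Prop) (d e : dist X) :
  All P d -> All P e -> All P (d ++ e).
Proof. by elim: d => //= p d IH [? /IH d_P] /d_P. Qed.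

Lemma All_bind (X Y : Type) (P : X -> Prop) (Q : Y -> Prop) (d : dist X) h :
  All P d -> (forall x, P x -> All Q (h x)) -> All Q (bind d h).
Proof.
move=> dP hQ; elim: d dP => //= p d IH [Pp /IH dQ]; apply: All_cat => //.
by elim: (h p.2) (hQ _ Pp) => //= q e IHe [? /IHe].
Qed.

Lemma eq_Ex_All (X : Type) (P : X -> Prop) (d : dist X) f g :
  All P d -> (forall x, P x -> f x = g x) -> Ex d f = Ex d g.
Proof.
move=> dP fg; elim: d dP => [|p d IH] /=; first by rewrite !Ex_nil.
by move=> [/fg fp /IH Ed]; rewrite !Ex_cons fp Ed.
Qed.

(* Without this assumption QMove is not injective on registers, hence not
   trace preserving. *)
Definition balr (k b : regs) : Prop := forall i, size (k i) = size (b i).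

Definition balanced (m : mem) : Prop := balr (kt m) (br m).

Lemma balr_upd k b i v w : 
  balr k b -> size v = size w -> balr (upd k i v) (upd b i w).
Proof. by move=> kb vw j; rewrite !updE; case: eqP. Qed.

Lemma qact_balr g k b : balr k b ->
  All (fun u => All (balr u) (qact g b)) (qact g k).
Proof.
move=> kb; case: g => [i|i j|i|i|i j] /=.
- by do !split; apply: balr_upd => //=; rewrite kb.
- have := kb i; case: (k i) (b i) => [|x s] [|y t] //= [st].
  have kb' := balr_upd i kb st; do !split.
  by apply: balr_upd => //=; rewrite kb'.
- have := kb i; case: (k i) (b i) => [|x s] [|y t] //= [st].
  by do !split; apply: balr_upd => //=; rewrite st.
- by have := kb i; case: (k i) (b i) => [|x s] [|y t] //= [st].
- case: eqP => _; first by [].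
  have := kb i; case: (k i) (b i) => [|x s] [|y t] //= _.
  have := kb j; case: (k j) (b j) => [|x' s'] [|y' t'] //= [st].
  by do !split; apply: balr_upd => //=; rewrite st.
Qed.

Lemma invsqrt2_norm : (sqrtC 2)^-1 * ((sqrtC 2)^-1)^* = 2^-1 :> algC.
Proof. by rewrite -normCK normfV ger0_norm ?sqrtC_ge0 // exprVn sqrtCK. Qed.

Lemma gateT_norm : ((1 + 'i) / sqrtC 2) * ((1 + 'i) / sqrtC 2)^* = 1 :> algC.
Proof.
rewrite rmorphM /= mulrACA invsqrt2_norm -normCK -['i]mulr1 normC2_rect ?rpred1 //.
by rewrite expr1n -mulr2n mulfV // pnatr_eq0.
Qed.

Lemma sum_diag2 (X : Type) (F : X -> X -> algC) (w1 w2 v1 v2 : algC) k1 k2 b1 b2 :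
    F k1 b2 = 0 -> F k2 b1 = 0 ->
  Ex [:: (w1, k1); (w2, k2)] (fun u =>
      \sum_(v <- [:: (v1, b1); (v2, b2)]) v.1^* * F u v.2)
    = w1 * (v1^* * F k1 b1) + w2 * (v2^* * F k2 b2).
Proof.
move=> e12 e21; rewrite !Ex_cons Ex_nil !big_cons !big_nil /= e12 e21.
by rewrite !mulr0 !addr0 !add0r.
Qed.

(** Orthonormality of the columns [x] and [y] of the Hadamard matrix, scaled by [c]. *)
Lemma gateH_sum (x y : bool) (c : algC) :
  (sqrtC 2)^-1 * (((sqrtC 2)^-1)^* * c) +
  (-1) ^+ x / sqrtC 2 * (((-1) ^+ y / sqrtC 2)^* * c) = (x == y)%:R * c.
Proof.
move: invsqrt2_norm; set h := (sqrtC 2)^-1 => hh; rewrite rmorphM rmorph_sign.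
rewrite mulrA hh [_ * h * _]mulrA mulrACA hh -mulrDl; congr (_ * c).
have half2 : 2^-1 + 2^-1 = 1 :> algC by rewrite [RHS]splitr !mul1r.
by case: x y => [] []; rewrite ?expr0 ?expr1 ?mulrNN ?mulN1r ?mulrN1 ?mulNr ?mul1r ?subrr.
Qed.

(** The left-hand side is the inner product of the images of the basis states [k] and [b]: on
    balanced pairs, gates are isometries. *)
Lemma qact_trace g k b : balr k b ->
  Ex (qact g k) (fun u => \sum_(v <- qact g b) v.1^* * (u == v.2)%:R)
    = (k == b)%:R.
Proof.
have conj1 : (1 : algC)^* = 1 by exact: rmorph1.
move=> kb; case: g => [i|i j|i|i|i j] /=.
- rewrite Ex_ret big_seq1 /= conj1 mul1r -upd_eq2 eqseq_cons eqxx /=.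
  by rewrite eq_regs_upd.
- have := kb i; case ki: (k i) => [|x s]; case bi: (b i) => [|y t] //= _.
    by rewrite Ex_ret big_seq1 /= conj1 mul1r.
  rewrite Ex_ret big_seq1 /= conj1 mul1r -upd_eq2 eqseq_cons andbCA eq_regs_upd.
  by rewrite -upd_eq2 andbCA -eqseq_cons -ki -bi eq_regs_upd.
- have := kb i; case ki: (k i) => [|x s]; case bi: (b i) => [|y t] //= _.
    by rewrite Ex_ret big_seq1 /= conj1 mul1r.
  have ne v w : (upd k i (v :: s) == upd b i (~~ v :: w))%:R = 0 :> algC.
    by rewrite -upd_eq2 eqseq_cons; case: v; rewrite andbF.
  rewrite (sum_diag2 (F := fun u v => (u == v)%:R) _ _ _ _ (ne false t) (ne true t)).
  have eqv v : (upd k i (v :: s) == upd b i (v :: t)) =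
      (upd k i [::] == upd b i [::]) && (s == t).
    by rewrite -upd_eq2 eqseq_cons eqxx.
  rewrite !eqv -(eq_regs_upd k b i) ki bi eqseq_cons andbCA -[in RHS]mulnb natrM.
  exact: gateH_sum.
- have := kb i; case ki: (k i) => [|x s]; case bi: (b i) => [|y t] //= _.
    by rewrite Ex_ret big_seq1 /= conj1 mul1r.
  rewrite Ex_cons Ex_nil big_seq1 /= addr0 rmorphXn.
  have [kbE | _] := eqVneq k b; last by rewrite !mulr0.
  move: ki; rewrite kbE bi => -[-> _]; rewrite mulr1 -exprMn.
  by rewrite gateT_norm expr1n.
- case: eqP => [_|ij]; first by rewrite Ex_ret big_seq1 /= conj1 mul1r.
  have := kb i; case ki: (k i) => [|x s]; case bi: (b i) => [|y t] //= _.
    by rewrite Ex_ret big_seq1 /= conj1 mul1r.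
  have := kb j; case kj: (k j) => [|x' s']; case bj: (b j) => [|y' t'] //= _.
    by rewrite Ex_ret big_seq1 /= conj1 mul1r.
  rewrite Ex_ret big_seq1 /= conj1 mul1r -upd_eq2 -(eq_regs_upd k b j) kj bj.
  rewrite !eqseq_cons; case: eqP => //= kbE.
  (* Agreement outside the target [j] includes the control register [i], so the control bits of ket
     and bra are equal. *)
  have : upd k j [::] i = upd b j [::] i by rewrite kbE.
  rewrite !updE; case: eqP => // _; rewrite ki bi => -[-> _].
  by case: x' y' y {kj bj bi} => [] [] [].
Qed.

Lemma balanced_putq q v m : balanced m -> size v.1 = size v.2 ->
  All balanced (putq q v m).
Proof.
case: m => r k b kb vw; case: q => [i|] /=; case: ifP => //= _; split=> //.
exact: balr_upd.
Qed.

Lemma balanced_takeq q m : balanced m ->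
  size (takeq q m).1.1 = size (takeq q m).1.2 /\ balanced (takeq q m).2.
Proof.
case: m => r k b kb; case: q => [i|] /=; split=> //; exact: balr_upd.
Qed.

Lemma balanced_init x : size x.2.1 = size x.2.2 -> balanced (init x).
Proof. by move=> xx; apply: balr_upd. Qed.

Lemma well_formedE (S : Type) (O : oracle S) :
  well_formed O <->
  forall k xs s, All (fun x => size x.2.2.1 = size x.2.2.2) (O k xs s).
Proof.
split=> wf k xs s; have := wf k xs s; elim: (O k xs s) => //= p d IH.
  by case/andP => /eqP ? /IH.
by case=> -> /IH ->; rewrite eqxx.
Qed.

Lemma balanced_outputs k m : balanced m ->
  All (fun x => size x.2.1 = size x.2.2) (outputs k m).
Proof. by move=> bm; rewrite /outputs; case: ifP => //= _; split. Qed.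

Lemma no_oracle_wf : well_formed no_oracle.
Proof. by []. Qed.

Lemma run_balanced (S : Type) (O : oracle S) n c s m :
  well_formed O -> balanced m -> All (fun x => balanced x.2) (run O n c s m).
Proof.
elim: c S O s m => /=.
- by [].
- move=> c1 IH1 c2 IH2 S O s m wf bm.
  by apply: (All_bind (IH1 _ _ _ _ wf bm)) => -[s1 m1] /= bm1; apply: IH2.
- move=> c IH S O s m wf bm; elim: {1}n => //= t IHt.
  by apply: (All_bind IHt) => -[s1 m1] /= bm1; apply: IH.
- move=> x c0 IH0 c1 IH1 c2 IH2 S O s m wf bm.
  by case: (cl m x) => [|[] _]; [apply: IH0 | apply: IH2 | apply: IH1].
- by move=> b x S O s m.
- by move=> x S O s m.
- by move=> x y S O s m.
- move=> g S O s m wf bm; have := qact_balr g bm.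
  elim: (qact g (kt m)) => //= u d IH [du /IH Hd]; apply: All_cat => // {Hd IH}.
  by elim: (qact g (br m)) du => //= v e IH [? /IH].
- move=> i x S O s m wf bm; have := bm i.
  case: (kt m i) (br m i) => [|b u] [|b' v] //= [uv]; case: ifP => //= _.
  by split=> //; apply: balr_upd.
- move=> k xs zs q S O s m /well_formedE wf bm.
  apply: (All_bind (wf _ _ _)) => -[s1 a] /= aa.
  by apply: All_bind (balanced_putq _ _ aa) _.
- move=> f IH xs qi zs qo S O s m wf bm.
  have := balanced_takeq qi bm; case: (takeq qi m) => v m1 /= [vv bm1].
  have bi : balanced (init ([seq cl m x | x <- xs], v)) by apply: balanced_init.
  apply: (All_bind (IH _ _ tt _ no_oracle_wf bi)) => -[_ m2] /= bm2.
  apply: (All_bind (balanced_outputs (size zs) bm2)) => a /= aa.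
  by apply: All_bind (balanced_putq _ _ aa) _.
Qed.

Lemma qexec_balanced f n k x : size x.2.1 = size x.2.2 ->
  All (fun y => size y.2.1 = size y.2.2) (qexec f n k x).
Proof.
move=> xx; apply: (All_bind (run_balanced n f tt no_oracle_wf (balanced_init xx))).
by move=> -[_ m] /= bm; apply: balanced_outputs.
Qed.

Lemma wp_trace n c m :
  balanced m -> wp no_oracle n c (fun _ => tr) tt m = tr m.
Proof.
elim: c m => /=.
- by move=> m _; rewrite wp_skip.
- move=> c1 IH1 c2 IH2 m bm; rewrite wp_seq -[RHS]IH1 //.
  by apply: (eq_Ex_All (run_balanced n c1 tt no_oracle_wf bm)) => -[[] m1] /= /IH2.
- move=> c IH m bm; rewrite wp_rep; elim: {2}n m bm => [|t IHt] m bm; first by rewrite wpn0.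
  rewrite wpnS -[RHS]IH //.
  by apply: (eq_Ex_All (run_balanced n c tt no_oracle_wf bm)) => -[[] m1] /= /IHt.
- move=> x c0 IH0 c1 IH1 c2 IH2 m bm; rewrite wp_case.
  by case: (cl m x) => [|[] _]; [apply: IH0 | apply: IH2 | apply: IH1].
- by move=> b x m _; rewrite wp_push.
- by move=> x m _; rewrite wp_pop.
- by move=> x y m _; rewrite wp_copy.
- by move=> g m bm; rewrite wp_quantum -[RHS](qact_trace g bm).
- move=> i x m bm; have := bm i; rewrite /wp /tr /=.
  case ki: (kt m i) => [|b u]; case bi: (br m i) => [|b' v] //= _.
    by rewrite Ex_ret.
  rewrite Ex_if Ex_ret /= -natrM mulnb -upd_eq2 -(eq_regs_upd (kt m) _ i) ki bi.
  by rewrite eqseq_cons andbCA.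
- move=> k xs zs q m bm; rewrite wp_ask Ex_ret Ex_putq /tr /=.
  case: q => [i|]; last by rewrite mul1r.
  by rewrite -natrM mulnb andbC eq_regs_upd.
- move=> f IH xs qi zs qo m bm; rewrite wp_call Ex_qexec.
  have [vv bm1] := balanced_takeq qi bm.
  (* The subroutine has a memory of its own: the trace is the product of that of the caller and that
     of the register handed over. *)
  have -> : tr m = tr (takeq qi m).2 * tr (init ([seq cl m x | x <- xs], (takeq qi m).1)).
    rewrite /tr -natrM mulnb; case: qi {vv bm1} => [i|] /=; last by rewrite eqxx andbT.
    by rewrite -(upd_eq2 [fsfun] [fsfun]) eqxx /= eq_regs_upd.
  rewrite -[tr (init _)]IH; last exact: balanced_init.
  rewrite /wp -ExMl; apply: eq_Ex => -[[] m2] /=.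
  rewrite Ex_outputs Ex_putq /tr /= -!natrM -(eq_regs_upd (kt m2) _ 0).
  case: qo => [i|].
    rewrite -(upd_eq2 (kt (takeq qi m).2)) -(eq_regs_upd (kt (takeq qi m).2) _ i).
    by do 4!case: (_ == _).
  by do 3!case: (_ == _).
Qed.

Lemma Ex_exec1 f n k xs : Ex (exec f n k xs) (fun=> 1) = 1.
Proof.
rewrite Ex_exec; under eq_wp do rewrite mulr1.
by rewrite wp_trace ?balanced_init // /tr eqxx.
Qed.

(** * Simulation of one interaction by another *)

(* The commands of c act on the classical registers from B on, and ask answers
   the oracle calls, with the registers below B as working space. *)
Fixpoint shift (B : nat) (ask : nat -> seq nat -> seq nat -> option nat -> cmd)
    (c : cmd) : cmd :=
  match c with
  | Skip => Skip
  | Seq c1 c2 => shift B ask c1 ;; shift B ask c2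
  | Rep c1 => Rep (shift B ask c1)
  | Case x c0 c1 c2 =>
      Case (B + x)%N (shift B ask c0) (shift B ask c1) (shift B ask c2)
  | Push b x => Push b (B + x)%N
  | Pop x => Pop (B + x)%N
  | Copy x y => Copy (B + x)%N (B + y)%N
  | Quantum g => Quantum g
  | Measure i x => Measure i (B + x)%N
  | Ask k xs zs q => ask k xs zs q
  | Call f xs qi zs qo => Call f (map (addn B) xs) qi (map (addn B) zs) qo
  end.

Fixpoint asks (n : nat) (c : cmd) : nat :=
  match c with
  | Seq c1 c2 => asks n c1 + asks n c2
  | Rep c1 => n * asks n c1
  | Case x c0 c1 c2 => asks n c0 + asks n c1 + asks n c2
  | Ask _ _ _ _ => 1
  | _ => 0
  end%N.

Lemma asks_poly c : exists e, forall n, (1 < n)%N -> (asks n c <= n ^ e)%N.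
Proof.
(* For n > 1, one more power of n absorbs the factor 2 of a sum. *)
have add a b x y n : (1 < n)%N -> (x <= n ^ a)%N -> (y <= n ^ b)%N ->
    (x + y <= n ^ (maxn a b).+1)%N.
  move=> n1 xa yb; rewrite expnS (@leq_trans (2 * n ^ maxn a b)) ?leq_mul2r ?n1 ?orbT //.
  rewrite mul2n -addnn leq_add //.
    by rewrite (leq_trans xa) // leq_pexp2l ?leq_maxl // ltnW.
  by rewrite (leq_trans yb) // leq_pexp2l ?leq_maxr // ltnW.
elim: c => /=; try by exists 0%N.
- move=> c1 [a Ha] c2 [b Hb]; exists (maxn a b).+1 => n n1.
  by apply: add => //; [apply: Ha | apply: Hb].
- by move=> c [a Ha]; exists a.+1 => n n1; rewrite expnS leq_mul2l Ha ?orbT.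
- move=> _ c0 [a Ha] c1 [b Hb] c2 [d Hd].
  exists (maxn (maxn a b).+1 d).+1 => n n1.
  by apply: (add) => //; [apply: add => //; [apply: Ha | apply: Hb] | apply: Hd].
Qed.

(** Only classical registers are shifted: the reductions keep no quantum data of their own between
    two commands of the simulated program. *)
Definition shifted B (m' m : mem) : Prop :=
  [/\ forall x, cl m' (B + x)%N = cl m x, kt m' = kt m & br m' = br m].

Section Simulation.
Context (S' S : Type) (O' : oracle S') (O : oracle S) (n B : nat).
Context (ask : nat -> seq nat -> seq nat -> option nat -> cmd).

(* R t s' r d: with t oracle calls left, the state s' of O' and the registers r
   below B stand for the (signed) mixture d of states of O. *)
Context (R : nat -> S' -> regs -> dist S -> Prop).

Definition sim_post t (p' : S' -> mem -> algC) (p : S -> mem -> algC) : Prop :=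
  forall s' m' d m, shifted B m' m -> R t s' (cl m') d ->
    p' s' m' = Ex d (p^~ m).

Hypothesis R_mono : forall t s' r d, R t.+1 s' r d -> R t s' r d.

Hypothesis R_local : forall t s' (r r' : regs) d,
  (forall x, (x < B)%N -> r x = r' x) -> R t s' r d -> R t s' r' d.

Hypothesis R_ask : forall k xs zs q t p' p, sim_post t p' p ->
  sim_post t.+1 (wp O' n (ask k xs zs q) p') (wp O n (Ask k xs zs q) p).

Lemma sim_le t u s' r d : (t <= u)%N -> R u s' r d -> R t s' r d.
Proof.
move=> /subnK <-; elim: (u - t)%N => // v IH.
by rewrite addSn => /R_mono.
Qed.

Lemma sim_set t s' m' d m x v :
    R t s' (cl m') d -> shifted B m' m ->
  R t s' (upd (cl m') (B + x) v) d /\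
  shifted B (set_cl m' (upd (cl m') (B + x) v)) (set_cl m (upd (cl m) x v)).
Proof.
move=> Rd [r_r kk bb]; split; last first.
  by split=> // y /=; rewrite !updE eqn_add2l r_r.
apply: R_local Rd => y y_B; rewrite updE; case: eqP => // yE.
by move: y_B; rewrite yE ltnNge leq_addr.
Qed.

Lemma sim_store t s' m' d m zs ys :
    R t s' (cl m') d -> shifted B m' m ->
  R t s' (store (map (addn B) zs) ys (cl m')) d /\
  shifted B (set_cl m' (store (map (addn B) zs) ys (cl m')))
    (set_cl m (store zs ys (cl m))).
Proof.
move=> Rd [r_r kk bb]; split; last by split=> // y /=; exact: store_shift.
by apply: R_local Rd => y y_B; rewrite store_scratch.
Qed.

Lemma sim_regs m' m k b :
  shifted B m' m -> shifted B (Mem (cl m') k b) (Mem (cl m) k b).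
Proof. by case=> r_r _ _. Qed.

(** The mixture concerns the private state of the oracle only, and both runs share the simulated
    memory. Every command other than [Ask] therefore commutes with the mixture by linearity, and
    [Ask] is the hypothesis [R_ask]. *)
Lemma sim_run c t p' p : sim_post t p' p ->
  sim_post (asks n c + t) (wp O' n (shift B ask c) p') (wp O n c p).
Proof.
elim: c t p' p => /=.
- move=> t p' p Hp s' m' d m mm Rd.
  by rewrite wp_skip (Hp _ _ _ _ mm Rd); apply: eq_Ex => s; rewrite wp_skip.
- move=> c1 IH1 c2 IH2 t p' p Hp s' m' d m mm; rewrite -addnA => Rd.
  rewrite wp_seq (IH1 _ _ _ (IH2 _ _ _ Hp) _ _ _ _ mm Rd).
  by apply: eq_Ex => s; rewrite wp_seq.
- move=> c IH t p' p Hp; suff loop u : sim_post (u * asks n c + t)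
      (wpn O' n (shift B ask c) u p') (wpn O n c u p) by exact: loop.
  elim: u => [|u IHu] s' m' d m mm Rd.
    by rewrite wpn0 (Hp _ _ _ _ mm Rd); apply: eq_Ex => s; rewrite wpn0.
  rewrite mulSn -addnA in Rd.
  by rewrite wpnS (IH _ _ _ IHu _ _ _ _ mm Rd); apply: eq_Ex => s; rewrite wpnS.
- move=> x c0 IH0 c1 IH1 c2 IH2 t p' p Hp s' m' d m mm Rd.
  rewrite wp_case; under eq_Ex do rewrite wp_case.
  (* Only one branch is run; the calls budgeted for the other two are given up by [sim_le]. *)
  have [-> _ _] := mm; case: (cl m x) => [|[] _].
  + by apply: IH0 Hp _ _ _ _ mm _; apply: sim_le Rd; lia.
  + by apply: IH2 Hp _ _ _ _ mm _; apply: sim_le Rd; lia.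
  + by apply: IH1 Hp _ _ _ _ mm _; apply: sim_le Rd; lia.
- move=> b x t p' p Hp s' m' d m mm Rd; rewrite wp_push.
  under eq_Ex do rewrite wp_push.
  have [r_r _ _] := mm; have [] := sim_set x (b :: cl m x) Rd mm.
  rewrite r_r => R1 mm1; exact: (Hp _ _ _ _ mm1 R1).
- move=> x t p' p Hp s' m' d m mm Rd; rewrite wp_pop.
  under eq_Ex do rewrite wp_pop.
  have [r_r _ _] := mm; have [] := sim_set x (behead (cl m x)) Rd mm.
  rewrite r_r => R1 mm1; exact: (Hp _ _ _ _ mm1 R1).
- move=> x y t p' p Hp s' m' d m mm Rd; rewrite wp_copy.
  under eq_Ex do rewrite wp_copy.
  have [r_r _ _] := mm; have [] := sim_set y (cl m x) Rd mm.
  rewrite r_r => R1 mm1; exact: (Hp _ _ _ _ mm1 R1).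
- move=> g t p' p Hp s' m' d m mm Rd; rewrite wp_quantum.
  under [RHS]eq_Ex do rewrite wp_quantum.
  rewrite Ex_swap; have [r_r -> ->] := mm; apply: eq_Ex => u.
  rewrite /Ex; under [RHS]eq_bigr do rewrite mulr_sumr.
  rewrite exchange_big; apply: eq_bigr => v _ /=.
  rewrite (Hp _ (Mem (cl m') u v.2) d (Mem (cl m) u v.2)) //.
  rewrite /Ex mulr_sumr; apply: eq_bigr => x _; exact: mulrCA.
- move=> i x t p' p Hp s' m' d m mm Rd; rewrite /wp /=.
  have [r_r -> ->] := mm.
  case: (kt m i) (br m i) => [|b u] [|b' v].
  + by rewrite Ex_ret (Hp _ _ _ _ mm Rd); apply: eq_Ex => s; rewrite Ex_ret.
  + by rewrite Ex_ret (Hp _ _ _ _ mm Rd); apply: eq_Ex => s; rewrite Ex_ret.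
  + by rewrite Ex_ret (Hp _ _ _ _ mm Rd); apply: eq_Ex => s; rewrite Ex_ret.
  + case: (b == b').
      have [] := sim_set x (b :: cl m x) Rd mm; rewrite r_r Ex_ret => Rd1 mm1.
      rewrite (Hp s' _ d _ (sim_regs (upd (kt m) i u) (upd (br m) i v) mm1)) //.
      by apply: eq_Ex => s; rewrite Ex_ret.
    by rewrite Ex_nil Ex0 // => s; rewrite Ex_nil.
- by move=> k xs zs q t p' p Hp; apply: R_ask.
- move=> f _ xs qi zs qo t p' p Hp s' m' d m mm Rd; rewrite wp_call.
  under [RHS]eq_Ex do rewrite wp_call.
  rewrite Ex_swap size_map; have [r_r km bm] := mm.
  have -> : [seq cl m' x | x <- map (addn B) xs] = [seq cl m x | x <- xs].
    by rewrite -map_comp; apply: eq_map => x; exact: r_r.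
  have [-> R1 mm1] : [/\ (takeq qi m').1 = (takeq qi m).1,
      R t s' (cl (takeq qi m').2) d & shifted B (takeq qi m').2 (takeq qi m).2].
    by case: qi => [i|] /=; rewrite ?km ?bm; split.
  apply: eq_Ex => a; under [RHS]eq_Ex do rewrite Ex_putq.
  rewrite Ex_putq ExMl; have [R2 mm2] := sim_store zs a.1 R1 mm1.
  have [_ /= -> ->] := mm1; congr (_ * _).
  exact: (Hp _ _ _ _ (sim_regs _ _ mm2) R2).
Qed.

End Simulation.

Lemma shift0 c : shift 0 Ask c = c.
Proof.
have map0 xs : map (addn 0) xs = xs by rewrite map_id_in.
by elim: c => //= [c1 -> c2 ->|c ->|x c0 -> c1 -> c2 ->|f _ xs qi zs qo] //; rewrite !map0.
Qed.

Section OracleSimulation.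
Context (S' S : Type) (O' : oracle S') (O : oracle S) (n : nat).
Context (R : nat -> S' -> dist S -> Prop).

Hypothesis R_mono : forall t s' d, R t.+1 s' d -> R t s' d.

Hypothesis R_oracle : forall k xs t s' d (f' : S' * cq -> algC) f,
    R t.+1 s' d ->
    (forall s1 d1 a, R t s1 d1 -> f' (s1, a) = Ex d1 (fun s => f (s, a))) ->
  Ex (O' k xs s') f' = Ex d (fun s => Ex (O k xs s) f).

(** The case without working space: the same program faces two oracles, and the relation ignores the
    registers. *)
Lemma sim_oracle c t p' p s' d m : R (asks n c + t) s' d ->
    (forall s1 d1 m1, R t s1 d1 -> p' s1 m1 = Ex d1 (p^~ m1)) ->
  wp O' n c p' s' m = Ex d (fun s => wp O n c p s m).
Proof.
pose R' t s' (_ : regs) d := R t s' d.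
have shifted0 m1 m2 : shifted 0 m1 m2 -> m1 = m2.
  case: m1 m2 => [r1 k1 b1] [r2 k2 b2] [/= r12 -> ->].
  by congr Mem; apply/fsfunP => x; rewrite -r12.
move=> Rd Hp; rewrite -[c in LHS]shift0.
have mm : shifted 0 m m by split.
apply: (@sim_run _ _ O' O n 0 Ask R' _ _ _ c t p' p _ s' m d m mm Rd) => //.
- by move=> t1 s1 r d1; apply: R_mono.
- move=> k xs zs q t1 p1' p1 Hp1 s1 m1 d1 _ /shifted0 <- Rd1; rewrite wp_ask.
  under [RHS]eq_Ex do rewrite wp_ask.
  apply: R_oracle Rd1 _ => s2 d2 a R2 /=; rewrite Ex_swap; apply: eq_Ex => m2.
  exact: (Hp1 _ m2 _ m2).
- by move=> s1 m1 d1 _ /shifted0 <- /Hp.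
Qed.

End OracleSimulation.

(** * Numbers of output strings and the transfer of answers *)

Lemma qexec_size f n k x : All (fun a => size a.1 = k) (qexec f n k x).
Proof.
have allT (d : dist (unit * mem)) : All (fun=> True) d by elim: d.
apply: (All_bind (allT _)) => -[_ m] _; rewrite /outputs.
by case: ifP => //= _; split; rewrite // size_map size_iota.
Qed.

Lemma exec_size f n k xs : All (fun ys => size ys = k) (exec f n k xs).
Proof.
by apply: (All_bind (qexec_size _ _ _ _)) => x xk; rewrite /discard_q; case: ifP.
Qed.

Lemma Ex_exec_1 f n xs g :
  Ex (exec f n 1 xs) g = Ex (exec f n 1 xs) (fun ys => g [:: fst_of ys]).
Proof. by apply: eq_Ex_All (exec_size _ _ _ _) _ => -[|y []]. Qed.

Lemma Ex_exec_2 f n xs g :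
  Ex (exec f n 2 xs) g =
    Ex (exec f n 2 xs) (fun ys => g [:: fst_of ys; snd_of ys]).
Proof. by apply: eq_Ex_All (exec_size _ _ _ _) _ => -[|y [|z []]]. Qed.

Lemma wp_call_1 (S : Type) (O : oracle S) n f xs z p s m :
  wp O n (Call f xs None [:: z] None) p s m =
    Ex (exec f n 1 [seq cl m x | x <- xs]) (fun ys =>
      p s (set_cl m (upd (cl m) z (fst_of ys)))).
Proof. by rewrite wp_call_c; exact: Ex_exec_1. Qed.

Lemma wp_call_2 (S : Type) (O : oracle S) n f xs z1 z2 p s m :
  wp O n (Call f xs None [:: z1; z2] None) p s m =
    Ex (exec f n 2 [seq cl m x | x <- xs]) (fun ys =>
      p s (set_cl m (upd (upd (cl m) z1 (fst_of ys)) z2 (snd_of ys)))).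
Proof. by rewrite wp_call_c; exact: Ex_exec_2. Qed.

(** Stops at the shorter of [k] and [zs], like the [zip] in [store], so that a query naming too few
    or too many registers gets the same treatment as in [Ask]. *)
Fixpoint copies (a k B : nat) (zs : seq nat) : cmd :=
  match k, zs with
  | k1.+1, z :: zs1 => Copy a (B + z)%N ;; copies a.+1 k1 B zs1
  | _, _ => Skip
  end.

Lemma wp_copies (S : Type) (O : oracle S) n a k B zs p s m : (a + k <= B)%N ->
  wp O n (copies a k B zs) p s m =
    p s (set_cl m (store (map (addn B) zs) [seq cl m x | x <- iota a k] (cl m))).
Proof.
elim: k a zs m => [|k IH] a [|z zs] m akB /=; rewrite ?wp_skip; try by case: m akB.
rewrite wp_seq wp_copy IH ?addSnnS //; congr (p s _); rewrite /store /=.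
congr (Mem (foldl _ _ (zip _ _)) _ _).
apply/eq_in_map => x; rewrite mem_iota updE => /andP[_ x_k].
by case: eqP => // xE; lia.
Qed.

(* Once the answer is in the registers from a on, the simulation of an oracle
   call ends in the same way in all reductions. *)
Lemma sim_copies (S' S : Type) (O' : oracle S') n B
    (R : nat -> S' -> regs -> dist S -> Prop) t p' p a k zs q v s' (r' : regs) d m' m ans :
    (forall t s' (r r' : regs) d,
       (forall x, (x < B)%N -> r x = r' x) -> R t s' r d -> R t s' r' d) ->
    (a + k <= B)%N -> [seq r' x | x <- iota a k] = ans ->
    sim_post B R t p' p -> R t s' r' d ->
    (forall x, r' (B + x)%N = cl m x) -> kt m' = kt m -> br m' = br m ->
  Ex (putq q v (set_cl m' r')) (wp O' n (copies a k B zs) p' s') =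
    Ex d (fun s => Ex (putq q v (set_cl m (store zs ans (cl m)))) (p s)).
Proof.
move=> R_local akB ansE Hp Rd r'r km bm; under [RHS]eq_Ex do rewrite Ex_putq.
rewrite Ex_putq ExMl /= km bm; congr (_ * _).
rewrite wp_copies //= ansE.
apply: (Hp _ _ _ (Mem _ _ _)); first by split=> // x /=; apply: store_shift.
by apply: R_local Rd => x xB; rewrite store_scratch.
Qed.

(** An empty register [z] plays the default value: a message missing from a query is read as the
    empty string, as with [fst_of] and [snd_of]. *)
Lemma nth_reg B z (m' m : mem) xs i :
    shifted B m' m -> cl m' z = [::] ->
  cl m' (nth z (map (addn B) xs) i) = nth [::] [seq cl m x | x <- xs] i.
Proof.
case=> mm _ _ mz; case: (ltnP i (size xs)) => [lt_i|le_i]; last by rewrite !nth_default ?size_map.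
by rewrite !(nth_map 0%N) // mm.
Qed.

(** * Uniform sampling of a polynomially bounded number *)

(* Register 0 holds the sample and register 1 the length still to be halved,
   both in unary.  Every halving doubles the sample and adds a random bit, so
   that the sample is uniform below a power of two. *)
Definition halve : cmd :=
  Case 1 Skip Skip (Pop 1 ;; Case 1 Skip Skip (Pop 1 ;; Push true 2)).

Definition double : cmd := Case 0 Skip Skip (Pop 0 ;; Push true 3 ;; Push true 3).

Definition flip : cmd :=
  Quantum (QNew 0) ;; Quantum (GateH 0) ;; Measure 0 5 ;;
  Case 5 Skip Skip (Push true 0).

Definition sample_step e : cmd :=
  Case 1 Skip Skip
    (reps e halve ;; Copy 2 1 ;; Copy 4 2 ;;
     reps e double ;; Copy 3 0 ;; Copy 4 3 ;; flip).

Definition sampler e : cmd := reps e (Push true 1) ;; reps e (sample_step e).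

Definition smem (x l t y : nat) (m : mem) : Prop :=
  [/\ cl m 0%N = nseq x true, cl m 1%N = nseq l true, cl m 2%N = nseq t true,
      cl m 3%N = nseq y true & cl m 4%N = [::]] /\
  (kt m = br m /\ kt m 0%N = [::]).

Section Sampler.
Context (S : Type) (O : oracle S) (n : nat).
Implicit Types (p : S -> mem -> algC) (s : S) (m : mem) (v : algC).

Lemma smem_set x l t y m i w x' l' t' y' :
    smem x l t y m -> i != 4%N ->
    (if i == 0%N then w = nseq x' true else x' = x) ->
    (if i == 1%N then w = nseq l' true else l' = l) ->
    (if i == 2%N then w = nseq t' true else t' = t) ->
    (if i == 3%N then w = nseq y' true else y' = y) ->
  smem x' l' t' y' (set_cl m (upd (cl m) i w)).
Proof.
case=> -[m0 m1 m2 m3 m4] kb i4 h0 h1 h2 h3; split=> //=; rewrite !updE !(eq_sym _ i).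
rewrite (negPf i4); split=> //.
- by move: h0; case: eqP => _ ->.
- by move: h1; case: eqP => _ ->.
- by move: h2; case: eqP => _ ->.
- by move: h3; case: eqP => _ ->.
Qed.

Lemma smem_push0 x l t y m : smem x l t y m ->
  smem x.+1 l t y (set_cl m (upd (cl m) 0 (true :: cl m 0%N))).
Proof.
by move=> mm; have [[m0 m1 m2 m3 _] _] := mm; apply: (smem_set mm); rewrite //= ?m0 ?m1 ?m2 ?m3.
Qed.

Lemma smem_push1 x l t y m : smem x l t y m ->
  smem x l.+1 t y (set_cl m (upd (cl m) 1 (true :: cl m 1%N))).
Proof.
by move=> mm; have [[m0 m1 m2 m3 _] _] := mm; apply: (smem_set mm); rewrite //= ?m0 ?m1 ?m2 ?m3.
Qed.

Lemma smem_push2 x l t y m : smem x l t y m ->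
  smem x l t.+1 y (set_cl m (upd (cl m) 2 (true :: cl m 2%N))).
Proof.
by move=> mm; have [[m0 m1 m2 m3 _] _] := mm; apply: (smem_set mm); rewrite //= ?m0 ?m1 ?m2 ?m3.
Qed.

Lemma smem_push3 x l t y m : smem x l t y m ->
  smem x l t y.+1 (set_cl m (upd (cl m) 3 (true :: cl m 3%N))).
Proof.
by move=> mm; have [[m0 m1 m2 m3 _] _] := mm; apply: (smem_set mm); rewrite //= ?m0 ?m1 ?m2 ?m3.
Qed.

Lemma smem_pop0 x l t y m : smem x.+1 l t y m ->
  smem x l t y (set_cl m (upd (cl m) 0 (behead (cl m 0%N)))).
Proof.
by move=> mm; have [[m0 m1 m2 m3 _] _] := mm; apply: (smem_set mm); rewrite //= ?m0 ?m1 ?m2 ?m3.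
Qed.

Lemma smem_pop1 x l t y m : smem x l.+1 t y m ->
  smem x l t y (set_cl m (upd (cl m) 1 (behead (cl m 1%N)))).
Proof.
by move=> mm; have [[m0 m1 m2 m3 _] _] := mm; apply: (smem_set mm); rewrite //= ?m0 ?m1 ?m2 ?m3.
Qed.

Lemma smem_copy21 x l t y m : smem x l t y m ->
  smem x t t y (set_cl m (upd (cl m) 1 (cl m 2%N))).
Proof. by move=> mm; have [[m0 m1 m2 m3 _] _] := mm; apply: (smem_set mm). Qed.

Lemma smem_clear2 x l t y m : smem x l t y m ->
  smem x l 0 y (set_cl m (upd (cl m) 2 (cl m 4%N))).
Proof. by move=> mm; have [[_ _ _ _ m4] _] := mm; apply: (smem_set mm). Qed.

Lemma smem_copy30 x l t y m : smem x l t y m ->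
  smem y l t y (set_cl m (upd (cl m) 0 (cl m 3%N))).
Proof. by move=> mm; have [[m0 m1 m2 m3 _] _] := mm; apply: (smem_set mm). Qed.

Lemma smem_clear3 x l t y m : smem x l t y m ->
  smem x l t 0 (set_cl m (upd (cl m) 3 (cl m 4%N))).
Proof. by move=> mm; have [[_ _ _ _ m4] _] := mm; apply: (smem_set mm). Qed.

Lemma wpn_fill u p s v x l t y m :
    (forall m', smem x (l + u) t y m' -> p s m' = v) ->
  smem x l t y m -> wpn O n (Push true 1) u p s m = v.
Proof.
elim: u l m => [|u IH] l m Hp mm; first by rewrite wpn0 Hp // addn0.
rewrite wpnS wp_push; apply: (IH l.+1); last exact: smem_push1.
by move=> m'; rewrite addSnnS; apply: Hp.
Qed.

(** Iterations after register 1 is exhausted do nothing, so a loop clocked by a power of n may run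
    longer than the work requires. *)
Lemma wpn_halve u p s v x l t y m : (l <= u)%N ->
    (forall m', smem x 0 (t + l./2) y m' -> p s m' = v) ->
  smem x l t y m -> wpn O n halve u p s m = v.
Proof.
elim: u l t m => [|u IH] l t m l_u Hp mm.
  by move: l_u Hp mm; rewrite leqn0 wpn0 => /eqP ->; rewrite addn0 => Hp /Hp.
rewrite wpnS wp_case; have [[_ -> _ _ _] _] := mm.
case: l l_u Hp mm => [|l] l_u Hp mm.
  by rewrite /= wp_skip; apply: IH Hp mm.
rewrite /= wp_seq wp_pop wp_case; have mm1 := smem_pop1 mm.
have [[_ -> _ _ _] _] := mm1; case: l l_u Hp mm mm1 => [|l] l_u Hp mm mm1.
  rewrite /= wp_skip; exact: (IH 0%N t _ (leq0n u) Hp mm1).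
rewrite /= wp_seq wp_pop wp_push; apply: (IH l t.+1); first by lia.
  by move=> m'; rewrite addSnnS; apply: Hp.
exact/smem_push2/smem_pop1.
Qed.

Lemma wpn_double u p s v x l t y m : (x <= u)%N ->
    (forall m', smem 0 l t (y + x.*2) m' -> p s m' = v) ->
  smem x l t y m -> wpn O n double u p s m = v.
Proof.
elim: u x y m => [|u IH] x y m x_u Hp mm.
  by move: x_u Hp mm; rewrite leqn0 wpn0 => /eqP ->; rewrite addn0 => Hp /Hp.
rewrite wpnS wp_case; have [[-> _ _ _ _] _] := mm.
case: x x_u Hp mm => [|x] x_u Hp mm.
  by rewrite /= wp_skip; apply: IH Hp mm.
rewrite /= wp_seq wp_pop wp_seq !wp_push; apply: (IH x y.+2) => //.
  by move=> m'; rewrite !addSnnS -doubleS; apply: Hp.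
exact/smem_push3/smem_push3/smem_pop0.
Qed.

Lemma wp_flip p s v0 v1 x l t y m :
    (forall m', smem x l t y m' -> p s m' = v0) ->
    (forall m', smem x.+1 l t y m' -> p s m' = v1) ->
  smem x l t y m -> wp O n flip p s m = 2^-1 * (v0 + v1).
Proof.
move=> H0 H1 mm; have [[m0 m1 m2 m3 m4] [kb k0]] := mm.
pose F k b := wp O n (Measure 0 5 ;; Case 5 Skip Skip (Push true 0)) p s (Mem (cl m) k b).
rewrite wp_seq wp_quantum /= Ex_ret big_seq1 -kb k0 /= wp_seq wp_quantum /= updE /=.
(* The measurement removes the coherences created by the Hadamard gate, leaving two diagonal terms
   of weight 1/2. *)
have F0 k a b : a != b -> F (upd k 0 [:: a]) (upd k 0 [:: b]) = 0.
  by move=> /negPf ab; rewrite /F wp_seq /wp /= !updE /= ab Ex_nil.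
have F1 k a : F (upd k 0 [:: a]) (upd k 0 [:: a]) = if a then v1 else v0.
  rewrite /F wp_seq {1}/wp /= !updE /= eqxx Ex_ret /= wp_case /= updE /=.
  have smem' : smem x l t y (Mem (upd (cl m) 5 (a :: cl m 5%N))
      (upd (upd k 0 [:: a]) 0 [::]) (upd (upd k 0 [:: a]) 0 [::])).
    by split; [split; rewrite /= updE | rewrite /= updE].
  by case: (a) smem' => sm; rewrite ?wp_push ?wp_skip; [apply/H1/smem_push0 | apply: H0].
rewrite (sum_diag2 (F := F) _ _ _ _ (F0 _ false true isT) (F0 _ true false isT)).
rewrite !F1 expr0 mul1r rmorph1 mul1r.
by rewrite !mulrA invsqrt2_norm mulrDr.
Qed.

(** [w] is the least power of two above [l], chosen before [x] because both outcomes of a coin must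
    lead to ranges of the same width. The product [x.+1 * l] does not grow, since [x] becomes at
    most [x.*2.+1] while [l] is halved; so [n ^ e] iterations suffice for each inner loop. *)
Lemma wpn_sample e u l : (l <= u)%N -> exists w, (l < w <= maxn 1 l.*2)%N /\
  forall x s m p g, (x.+1 * l <= n ^ e)%N ->
    (forall x' m', smem x' 0 0 0 m' -> p s m' = g x') -> smem x l 0 0 m ->
  wpn O n (sample_step e) u p s m = w%:R^-1 * \sum_(i < w) g (x * w + i)%N.
Proof.
elim: u l => [|u IH] l l_u.
  exists 1%N; split; first by lia.
  move=> x s m p g _ Hp mm; rewrite wpn0 big_ord1 invr1 mul1r muln1 addn0.
  by apply: Hp; move: l_u mm; rewrite leqn0 => /eqP ->.
case: l l_u => [|l] l_u.
  have [|w [w_bd Hw]] := IH 0%N; first by [].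
  exists w; split=> // x s m p g xl Hp mm.
  rewrite wpnS wp_case; have [[_ -> _ _ _] _] := mm; rewrite /= wp_skip.
  exact: Hw.
have [|w [w_bd Hw]] := IH l.+1./2; first by lia.
exists w.*2; split=> [|x s m p g xl Hp mm]; first by lia.
rewrite wpnS wp_case; have [[_ -> _ _ _] _] := mm.
rewrite /= wp_seq wp_reps; apply: wpn_halve mm => [|m1 mm1]; first by nia.
rewrite add0n in mm1.
rewrite wp_seq wp_copy wp_seq wp_copy; have mm2 := smem_clear2 (smem_copy21 mm1).
rewrite wp_seq wp_reps; apply: wpn_double mm2 => [|m3 mm3]; first by nia.
rewrite add0n in mm3; rewrite !wp_seq !wp_copy wp_seq wp_copy.
have mm4 := smem_clear3 (smem_copy30 mm3).
pose v x' := w%:R^-1 * \sum_(i < w) g (x' * w + i)%N.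
rewrite (wp_flip (v0 := v x.*2) (v1 := v x.*2.+1) _ _ mm4).
- rewrite /v -mulrDr mulrA -invfM -natrM mul2n; congr (_ * _).
  rewrite -[w.*2]addnn big_split_ord /=; congr (_ + _); apply: eq_bigr => i _; congr g; lia.
- by move=> m' mm'; apply: (Hw _ _ _ _ _ _ Hp mm'); nia.
- by move=> m' mm'; apply: (Hw _ _ _ _ _ _ Hp mm'); nia.
Qed.

End Sampler.

(** The lower bound makes the range exceed the number of queries, the upper one limits the loss of
    the reductions; its successor covers the case [n ^ e = 0], where [w] is 1. *)
Lemma sampler_uniform e n : exists w, (n ^ e < w <= (n ^ e).*2.+1)%N /\
  forall f, Ex (exec (sampler e) n 1 [::]) f =
    w%:R^-1 * \sum_(i < w) f [:: nseq i true].
Proof.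
have [w [w_bd Hw]] := wpn_sample no_oracle n e (leqnn (n ^ e)).
exists w; split=> [|f]; first by lia.
pose g i := f [:: nseq i true].
rewrite Ex_exec wp_seq wp_reps; apply: (@wpn_fill _ _ _ _ _ _ _ 0 0 0 0); last first.
  have load0 x : load [::] x = [::] by rewrite loadE nth_nil.
  by split; [split; exact: load0 | split; rewrite //= updE].
move=> m mm; rewrite wp_reps (Hw 0%N _ _ _ g _ _ mm) ?mul1n //.
by move=> x' m' [[/= -> _ _ _ _] [kb _]]; rewrite /tr kb eqxx mul1r.
Qed.

(** * Hybrid games *)

Local Arguments putq : simpl never.

Lemma wpn_push (S : Type) (O : oracle S) n b x u p s m :
  wpn O n (Push b x) u p s m = p s (set_cl m (upd (cl m) x (nseq u b ++ cl m x))).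
Proof.
elim: u m => [|u IH] m; first by rewrite wpn0 upd_id //; case: m.
rewrite wpnS wp_push IH /= updE eqxx upd_upd; congr (p s (Mem (upd _ _ _) _ _)).
by elim: u {IH} => //= u ->.
Qed.

Lemma ute_encrypt_size P n ek m :
  All (fun c => size c.1 = ute_nct P) (ute_encrypt P n ek m).
Proof. exact: qexec_size. Qed.

Lemma Ex_hybrid_encrypt P N n ek m f :
  Ex (ute_encrypt (hybrid P N) n ek m) f =
    Ex (exec (ute_gen P) n 1 [:: unary n]) (fun ks =>
      Ex (ute_encrypt P n (fst_of ks) m) (fun c =>
        Ex (ncer_encrypt N n ek (fst_of ks)) (fun c2 => f (c2 :: c.1, c.2)))).
Proof.
rewrite /ute_encrypt Ex_qexec; set m0 := init _.
have m0E x : cl m0 x = nth [::] [:: ek; m] x by exact: loadE.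
have [k0 b0] : kt m0 0%N = [::] /\ br m0 0%N = [::] by rewrite /= updE.
have kb0 : upd (kt m0) 0 [::] = upd (br m0) 0 [::] by [].
move: m0E k0 b0 kb0; move: m0 => m0 m0E k0 b0 kb0 /=.
rewrite wp_seq wp_rep wpn_push wp_seq wp_call_1 /= updE eqxx m0E nth_default // cats0.
apply: eq_Ex => ks; rewrite wp_seq wp_call_cq size_iota /=.
rewrite !updE eqxx m0E /=; apply: eq_Ex_All (ute_encrypt_size _ _ _ _) _ => -[c [u v]] /= c_nct.
rewrite Ex_putq /= k0 b0 eqxx mul1r wp_call_1 /=.
(* The strings of the one-time ciphertext may overwrite the message in register 1, but not the
   one-time key, which is still to be encrypted. *)
rewrite /ncer_encrypt Ex_bind !store_iota /= !updE c_nct minnn.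
rewrite add1n ltnS ltnNge leqnSn eqxx m0E /=; apply: eq_Ex => c2.
rewrite Ex_ret Ex_outputs /= !upd_upd kb0 eqxx mul1r !updE eqxx; congr (f (_ :: _, _)).
apply: (@eq_from_nth _ [::]); rewrite size_map size_iota // => i i_nct.
rewrite (nth_map 0%N) ?size_iota // nth_iota // updE store_iota c_nct minnn.
by rewrite /= add1n subSS subn0 !ltnS i_nct.
Qed.

(* Started in state i, this is the i-th hybrid. *)
Definition threshold (P : ute) (n : nat) (ek : bits) : oracle nat := fun _ ms i =>
  c <~ ute_encrypt P n ek (if (0 < i)%N then snd_of ms else fst_of ms);
  ret (i.-1, c).

(* The query made in state Some 0, answered by f, is the one where two
   consecutive hybrids differ; None means that it is past. *)
Definition plant (P : ute) (S : Type) (n : nat) (ek : bits)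
    (f : seq bits -> S -> dist (S * cq)) : oracle (S * option nat) := fun _ ms s =>
  if s.2 is Some 0 then '(s1, a) <~ f ms s.1; ret ((s1, None), a)
  else c <~ ute_encrypt P n ek (if s.2 then snd_of ms else fst_of ms);
       ret ((s.1, omap predn s.2), c).

(* The one-time key and its encryption are chosen in advance. *)
Definition planted (P : ute) (N : ncer) (n : nat) (ek : bits) (b : bool) :
    oracle (bits * bits * option nat) :=
  plant (hybrid P N) n ek (fun ms s =>
    c <~ ute_encrypt P n s.1 (if b then snd_of ms else fst_of ms);
    ret (s, (s.2 :: c.1, c.2))).

Lemma Ex_ncer_encrypt N n ek m f :
  Ex (ncer_encrypt N n ek m) f =
    Ex (exec (nce_enc N) n 1 [:: ek; m]) (fun xs => f (fst_of xs)).
Proof. by rewrite Ex_bind; apply: eq_Ex => xs; rewrite Ex_ret. Qed.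

Lemma Ex_challenger P limit n ek b k ms i f :
    (if limit is Some q then (i < q)%N else true) ->
  Ex (ute_challenger P limit n ek b k ms i) f =
    Ex (ute_encrypt P n ek (if b then snd_of ms else fst_of ms))
       (fun c => f (i.+1, c)).
Proof.
by move=> i_q; rewrite /ute_challenger i_q Ex_bind; apply: eq_Ex => c; rewrite Ex_ret.
Qed.

Lemma Ex_threshold P n ek k ms i f :
  Ex (threshold P n ek k ms i) f =
    Ex (ute_encrypt P n ek (if (0 < i)%N then snd_of ms else fst_of ms))
       (fun c => f (i.-1, c)).
Proof. by rewrite Ex_bind; apply: eq_Ex => c; rewrite Ex_ret. Qed.

Lemma Ex_plant P (S : Type) n ek (h : seq bits -> S -> dist (S * cq)) k ms s f :
  Ex (plant P n ek h k ms s) f =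
    if s.2 is Some 0 then Ex (h ms s.1) (fun x => f ((x.1, None), x.2))
    else Ex (ute_encrypt P n ek (if s.2 then snd_of ms else fst_of ms))
            (fun c => f ((s.1, omap predn s.2), c)).
Proof.
case: s => s [[|i]|] /=; rewrite Ex_bind; apply: eq_Ex => c; rewrite ?Ex_ret //.
by case: c => s1 a; rewrite Ex_ret.
Qed.

Lemma wp_threshold0 P n ek A p i m :
  wp (ute_challenger P None n ek false) n A (fun _ => p) i m =
    wp (threshold P n ek) n A (fun _ => p) 0%N m.
Proof.
pose R (_ _ : nat) d := d = ret 0%N.
rewrite -[RHS](Ex_ret 0%N (fun j => wp (threshold P n ek) n A (fun _ => p) j m)).
apply: (@sim_oracle _ _ _ _ n R _ _ A 0) => //; last by move=> s1 d1 m1 ->; rewrite Ex_ret.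
move=> k xs t s' d f' f -> ff; rewrite Ex_ret Ex_challenger // Ex_threshold; apply: eq_Ex => c.
by rewrite (ff _ _ _ erefl) Ex_ret.
Qed.

(** The counter drops by one per query and starts at no less than their number, so no query finds it
    at 0. This is what the count of remaining calls in the simulation relation is for. *)
Lemma wp_threshold P n ek A p i j m : (asks n A <= j)%N ->
  wp (ute_challenger P None n ek true) n A (fun _ => p) i m =
    wp (threshold P n ek) n A (fun _ => p) j m.
Proof.
pose R t (_ : nat) d := exists2 j, (t <= j)%N & d = ret j.
move=> Aj; rewrite -[RHS](Ex_ret j (fun j => wp (threshold P n ek) n A (fun _ => p) j m)).
apply: (@sim_oracle _ _ _ _ n R _ _ A 0).
- by move=> t s' d [j' tj ->]; exists j'; rewrite // ltnW.
- move=> k xs t s' d f' f [[|j'] //= tj ->] ff.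
  rewrite Ex_ret Ex_challenger // Ex_threshold; apply: eq_Ex => c.
  by rewrite (ff _ (ret j')) ?Ex_ret //; exists j'.
- by exists j; rewrite ?addn0.
- by move=> s1 d1 m1 [j' _ ->]; rewrite Ex_ret.
Qed.

(** Deferred sampling: before query [i], a state of [threshold] stands for the mixture over all
    planted keys and ciphertexts, which that query resolves. Hybrids [i] and [i.+1] answer query [i]
    with the first and the second message respectively, hence the index [i + b]. *)
Lemma wp_planted P N n ek (b : bool) A p i m :
  wp (threshold (hybrid P N) n ek) n A (fun _ => p) (i + b)%N m =
    Ex (exec (ute_gen P) n 1 [:: unary n]) (fun ks =>
      Ex (ncer_encrypt N n ek (fst_of ks)) (fun ct =>
        wp (planted P N n ek b) n A (fun _ => p) ((fst_of ks, ct), Some i) m)).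
Proof.
pose seeds (o : option nat) : dist (bits * bits * option nat) :=
  ks <~ exec (ute_gen P) n 1 [:: unary n];
  ct <~ ncer_encrypt N n ek (fst_of ks); ret ((fst_of ks, ct), o).
have Ex_seeds o f : Ex (seeds o) f =
    Ex (exec (ute_gen P) n 1 [:: unary n]) (fun ks =>
      Ex (ncer_encrypt N n ek (fst_of ks)) (fun ct => f ((fst_of ks, ct), o))).
  rewrite Ex_bind; apply: eq_Ex => ks; rewrite Ex_bind; apply: eq_Ex => ct.
  by rewrite Ex_ret.
pose R (_ : nat) j d := (exists2 i, j = (i + b)%N & d = seeds (Some i)) \/
  (j = 0%N /\ exists s, d = ret (s, None)).
rewrite -(Ex_seeds _ (fun s => wp (planted P N n ek b) n A (fun _ => p) s m)).
apply: (@sim_oracle _ _ _ _ n R _ _ A 0) => //.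
- move=> k xs t0 j0 d f' f [[j -> ->] | [-> [s ->]]] ff; rewrite Ex_threshold.
    rewrite Ex_seeds; under [RHS]eq_Ex do under eq_Ex do rewrite Ex_plant.
    case: j => [|j].
      rewrite Ex_hybrid_encrypt; apply: eq_Ex => ks; rewrite Ex_swap.
      apply: eq_Ex => ct; rewrite /= [RHS]Ex_bind add0n lt0b.
      apply: eq_Ex => c; rewrite Ex_ret.
      rewrite (ff _ (ret (fst_of ks, ct, None))) ?Ex_ret //.
      by right; split; [case: (b) | eexists].
    have Rj : R t0 (j + b)%N (seeds (Some j)) by left; exists j.
    rewrite addSn; under eq_Ex do rewrite (ff _ _ _ Rj).
    by rewrite Ex_swap Ex_seeds.
  rewrite Ex_ret Ex_plant; apply: eq_Ex => c.
  by rewrite (ff _ (ret (s, None))) ?Ex_ret //; right; split=> //; exists s.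
- by left; exists i.
- move=> j d m1 [[i' _ ->] | [_ [s ->]]]; last by rewrite Ex_ret.
  rewrite Ex_cst // Ex_seeds -[RHS](Ex_exec1 (ute_gen P) n 1 [:: unary n]).
  apply: eq_Ex => ks; rewrite Ex_ncer_encrypt; exact: Ex_exec1.
Qed.

(** * The reduction to non-committing security *)

Local Arguments copies : simpl never.
Local Arguments load : simpl never.

(* Working space of the reductions: 0 holds 1^n, 1 the counter of plant, 2 the
   planted one-time key, 3 its ciphertext, 4 the decryption key or the state of
   nce_fake, 5 a fresh one-time key or the encryption key, 6 nothing, and from 7
   on the answer to the current query. *)
Definition base (P : ute) : nat := 7 + (ute_nct P).+1.

(** [Case] has to separate the three situations of [plant] by the top bit: none at the planted
    query, 1 before it, 0 after it. *)
Definition counter (o : option nat) : bits :=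
  if o is Some i then nseq i true else [:: false].

Definition nce_fresh (P : ute) (x : nat) (q : option nat) : cmd :=
  Call (ute_gen P) [:: 0]%N None [:: 5]%N None ;;
  Ask 0 [:: 5]%N [:: 7]%N None ;;
  Call (ute_enc P) [:: 5%N; x] None (iota 8 (ute_nct P)) q.

Definition nce_ask (P : ute) (b : bool) (_ : nat) (xs zs : seq nat)
    (q : option nat) : cmd :=
  let ms := map (addn (base P)) xs in
  Case 1
    (Copy 3 7 ;; Push false 1 ;;
     Call (ute_enc P) [:: 2%N; nth 6%N ms b] None (iota 8 (ute_nct P)) q)
    (nce_fresh P (nth 6%N ms 0) q)
    (Pop 1 ;; nce_fresh P (nth 6%N ms 1) q) ;;
  copies 7 (ute_nct P).+1 (base P) zs.

(** The challenge may precede all encryption queries, but it is answered together with a decryption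
    key. That key waits in register 4, out of reach of the simulated first stage, until [adv_B] is
    run. *)
Definition nce_adv (P : ute) (D : ute_adv) (e : nat) (b : bool) : cmd :=
  Call (sampler e) [::] None [:: 1]%N None ;;
  Call (ute_gen P) [:: 0]%N None [:: 2]%N None ;;
  Ask 1 [:: 2]%N [:: 3; 4]%N None ;;
  Copy 0 (base P) ;;
  shift (base P) (nce_ask P b) (adv_A D) ;;
  Call (adv_B D) (4%N :: iota (base P) (adv_nst D)) None [:: 0]%N None.

Lemma store_regs (r : regs) a k ys : size ys = k ->
  [seq store (iota a k) ys r x | x <- iota a k] = ys.
Proof.
move=> <-; apply: (@eq_from_nth _ [::]); rewrite size_map size_iota // => i i_k.
rewrite (nth_map 0%N) ?size_iota // nth_iota // store_iota minnn leq_addr.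
by rewrite ltn_add2l i_k addKn.
Qed.

Lemma answer_regs (r : regs) k ys : size ys = k ->
  [seq store (iota 8 k) ys r x | x <- iota 7 k.+1] = r 7%N :: ys.
Proof. by move=> ys_k; rewrite /= store_regs // store_iota. Qed.

Lemma store_low k ys (r : regs) x : (x < 8)%N -> store (iota 8 k) ys r x = r x.
Proof. by move=> x8; rewrite store_iota leqNgt x8. Qed.

Lemma sim_encrypt (S' S : Type) (O' : oracle S') P n
    (R : nat -> S' -> regs -> dist S -> Prop) t p' p x y q zs s' d m' m :
    (forall t s' (r r' : regs) d,
       (forall x, (x < base P)%N -> r x = r' x) -> R t s' r d -> R t s' r' d) ->
    sim_post (base P) R t p' p -> shifted (base P) m' m ->
    (forall ys, R t s' (store (iota 8 (ute_nct P)) ys (cl m')) d) ->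
  wp O' n (Call (ute_enc P) [:: x; y] None (iota 8 (ute_nct P)) q)
    (wp O' n (copies 7 (ute_nct P).+1 (base P) zs) p') s' m' =
  Ex (ute_encrypt P n (cl m' x) (cl m' y)) (fun c => Ex d (fun s =>
    Ex (putq q c.2 (set_cl m (store zs (cl m' 7%N :: c.1) (cl m)))) (p s))).
Proof.
move=> R_local Hp mm Rd; rewrite wp_call_cq size_iota.
apply: eq_Ex_All (ute_encrypt_size _ _ _ _) _ => c c_nct.
have [r_r km bm] := mm.
apply: (sim_copies _ _ _ _ _ R_local _ _ Hp (Rd c.1) _ km bm) => //.
  exact: answer_regs.
move=> z; rewrite store_iota c_nct minnn -r_r; case: ifP => // /andP[_].
by rewrite /base; lia.
Qed.

Lemma shifted_upd B m' m x v : (x < B)%N -> shifted B m' m ->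
  shifted B (set_cl m' (upd (cl m') x v)) m.
Proof.
move=> xB [r_r km bm]; split=> // z /=; rewrite updE r_r.
by case: eqP => // xE; move: xB; rewrite -xE ltnNge leq_addr.
Qed.

Definition nce_inv (n : nat) (sk ct dk : bits) (_ : nat) (used : bool) (r : regs)
    (d : dist (bits * bits * option nat)) : Prop :=
  [/\ used, r 0%N = unary n, r 2%N = sk, r 3%N = ct & r 4%N = dk] /\
  r 6%N = [::] /\ exists2 o, r 1%N = counter o & d = ret ((sk, ct), o).

Lemma nce_inv_local P n sk ct dk t used (r r' : regs) d :
    (forall x, (x < base P)%N -> r x = r' x) ->
  nce_inv n sk ct dk t used r d -> nce_inv n sk ct dk t used r' d.
Proof. by move=> rr'; rewrite /nce_inv !rr'. Qed.

(** The condition on [x] keeps the message off registers 5 and 7, which are overwritten before it is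
    read; 6 is the default register of [nce_ask]. *)
Lemma nce_fresh_sim P N n ek dk0 b sk ct dk t x q zs used d m' m p' p :
    sim_post (base P) (nce_inv n sk ct dk) t p' p -> shifted (base P) m' m ->
    nce_inv n sk ct dk t used (cl m') d -> x = 6%N \/ (base P <= x)%N ->
  wp (nc_challenger N n ek dk0 b) n (nce_fresh P x q)
    (wp (nc_challenger N n ek dk0 b) n (copies 7 (ute_nct P).+1 (base P) zs) p')
    used m' =
  Ex (ute_encrypt (hybrid P N) n ek (cl m' x)) (fun c => Ex d (fun s =>
    Ex (putq q c.2 (set_cl m (store zs c.1 (cl m)))) (p s))).
Proof.
move=> Hp mm [[h0 h1 h2 h3 h4] [h5 [o h6 h7]]] x_low.
rewrite Ex_hybrid_encrypt wp_seq wp_call_1 /= h1.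
(* The oracle encrypts the one-time key before the message is encrypted, contrary to [hybrid_enc];
   given the key, the two are independent. *)
apply: eq_Ex => ks; rewrite wp_seq wp_ask /= Ex_bind updE /= Ex_swap.
apply: eq_Ex => c2; rewrite Ex_ret Ex_putq /= mul1r.
rewrite (sim_encrypt _ _ _ _ _ _ (@nce_inv_local P n sk ct dk) Hp (d := d) (m := m)) /=.
- rewrite !updE /=.
  have -> : (x == 7%N) = false by move: x_low; rewrite /base; lia.
  by have -> : (x == 5%N) = false by move: x_low; rewrite /base; lia.
- have [r_r km bm] := mm; split=> // z; rewrite /= /store /= !updE.
  by rewrite /base -r_r.
- move=> ys; rewrite /nce_inv !store_low //= /store /= !updE /=.
  by split=> //; split=> //; exists o.
Qed.

Lemma nth_msg B xs i : nth 6%N (map (addn B) xs) i = 6%N \/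
  (B <= nth 6 (map (addn B) xs) i)%N.
Proof.
case: (ltnP i (size xs)) => [i_xs|xs_i]; last by left; rewrite nth_default ?size_map.
by right; rewrite (nth_map 0%N) // leq_addr.
Qed.

Lemma nce_ask_sim P N n ek dk0 g b sk ct dk k xs zs q t p' p :
    sim_post (base P) (nce_inv n sk ct dk) t p' p ->
  sim_post (base P) (nce_inv n sk ct dk) t.+1
    (wp (nc_challenger N n ek dk0 g) n (nce_ask P b k xs zs q) p')
    (wp (planted P N n ek b) n (Ask k xs zs q) p).
Proof.
move=> Hp used m' d m mm inv; have [[h0 h1 h2 h3 h4] [h5 [o h6 h7]]] := inv.
have msg i := nth_reg xs i mm h5.
rewrite h7 Ex_ret wp_ask Ex_plant wp_seq wp_case h6.
case: o h6 h7 inv => [[|j]|] h6 h7 inv /=.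
- rewrite wp_seq wp_copy wp_seq wp_push.
  rewrite (sim_encrypt _ _ _ _ _ _ (@nce_inv_local P n sk ct dk) Hp
    (d := ret ((sk, ct), None)) (m := m)) /=.
  + rewrite [RHS]Ex_bind !updE /= h2 h3.
    have [-> ->] : (nth 6%N (map (addn (base P)) xs) b == 1%N) = false /\
        (nth 6%N (map (addn (base P)) xs) b == 7%N) = false.
      by move: (nth_msg (base P) xs b); move: (nth _ _ _) => v; rewrite /base; lia.
    rewrite msg.
    have -> : nth [::] [seq cl m x | x <- xs] b =
        if b then snd_of [seq cl m x | x <- xs] else fst_of [seq cl m x | x <- xs].
      by case: (b).
    by apply: eq_Ex => c; rewrite !Ex_ret.
  + have [r_r km bm] := mm; split=> // z; rewrite /= !updE.
    by rewrite /base -r_r.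
  + move=> ys; rewrite /nce_inv !store_low // !updE /=.
    by split=> //; split=> //; exists None; rewrite // h6.
- rewrite wp_seq wp_pop.
  set m1 := set_cl _ _.
  have mm1 : shifted (base P) m1 m.
    by have [r_r km bm] := mm; split=> // z; rewrite /= !updE /base -r_r.
  have inv1 : nce_inv n sk ct dk t used (cl m1) (ret ((sk, ct), Some j)).
    rewrite /nce_inv !updE /=.
    by split=> //; split=> //; exists (Some j); rewrite // h6.
  rewrite (nce_fresh_sim _ _ _ _ _ _ Hp mm1 inv1 (nth_msg _ _ _)) /= updE.
  have -> : (nth 6%N (map (addn (base P)) xs) 1 == 1%N) = false.
    by move: (nth_msg (base P) xs 1); move: (nth _ _ _) => v; rewrite /base; lia.
  by rewrite msg; apply: eq_Ex => c; rewrite Ex_ret.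
- rewrite (nce_fresh_sim _ _ _ _ _ _ Hp mm inv (nth_msg _ _ _)).
  by rewrite msg h7; apply: eq_Ex => c; rewrite Ex_ret.
Qed.

Definition final (D : ute_adv) n (dk : bits) (m : mem) : algC :=
  tr m * Ex (exec (adv_B D) n 1 (dk :: [seq cl m i | i <- iota 0 (adv_nst D)]))
    (fun out => (fst_of out == [:: true])%:R).

Definition start (n : nat) : mem := init (cq0 [:: unary n]).

Lemma map_shifted B m' m k : shifted B m' m ->
  [seq cl m' i | i <- iota B k] = [seq cl m i | i <- iota 0 k].
Proof.
case=> mm _ _; rewrite -[B in iota B]addn0 iotaDl -map_comp.
by apply: eq_map => i; exact: mm.
Qed.

Lemma shifted_start B m n : (1 < B)%N -> kt m = kt (start n) -> br m = br (start n) ->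
    cl m 0%N = unary n -> (forall x, (B <= x)%N -> cl m x = [::]) ->
  shifted B (set_cl m (upd (cl m) B (cl m 0%N))) (start n).
Proof.
move=> B1 km bm m0 mB; split=> //= x; rewrite updE loadE m0.
case: x => [|x]; first by rewrite addn0 eqxx.
by rewrite /= nth_nil mB ?leq_addr //; case: eqP => //; lia.
Qed.

Lemma wp_nce_adv P N D e b n ek dk0 g w :
    (forall f, Ex (exec (sampler e) n 1 [::]) f =
      w%:R^-1 * \sum_(i < w) f [:: nseq i true]) ->
  Ex (exec_adv (nc_challenger N n ek dk0 g) false (nce_adv P D e b) n 1)
     (fun x => (fst_of x.2 == [:: true])%:R) =
  w%:R^-1 * \sum_(i < w) Ex (exec (ute_gen P) n 1 [:: unary n]) (fun ks =>
    Ex (nc_challenger N n ek dk0 g 1 [:: fst_of ks] false) (fun x =>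
      wp (planted P N n ek b) n (adv_A D) (fun _ => final D n (snd_of x.2.1))
         ((fst_of ks, fst_of x.2.1), Some (i : nat)) (start n))).
Proof.
move=> unif; rewrite Ex_exec_adv -/(start n).
rewrite wp_seq wp_call_1 unif; congr (_ * _); apply: eq_bigr => i _.
rewrite wp_seq wp_call_1 /= updE /= loadE /=; apply: eq_Ex => ks.
(* The first challenge answer consists of exactly two strings, so it fills both registers 3 and
   4. *)
have answer : All (fun x : bool * cq => x.1 /\ exists ct dk, x.2 = cq0 [:: ct; dk])
    (nc_challenger N n ek dk0 g 1 [:: fst_of ks] false).
  rewrite /nc_challenger /=; case: g.
    apply: (@All_bind _ _ (fun=> True)) => [|[ct st] _].
      by elim: (ncer_fake _ _ _).
    apply: (@All_bind _ _ (fun=> True)) => [|dk _]; first by elim: (ncer_reveal _ _ _ _).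
    by split=> //; split=> //; exists ct, dk.
  apply: (@All_bind _ _ (fun=> True)) => [|ct _]; first by elim: (ncer_encrypt _ _ _ _).
  by split=> //; split=> //; exists ct, dk0.
rewrite wp_seq wp_ask /= updE /=; apply: eq_Ex_All answer _ => -[used a] /= [-> [ct [dk ->]]].
rewrite Ex_putq /= mul1r wp_seq wp_copy wp_seq; set m1 := Mem _ _ _.
have m1E x : cl m1 x = if x == 4%N then dk else if x == 3%N then ct else
    if x == 2%N then fst_of ks else if x == 1%N then nseq i true else
    nth [::] [:: unary n] x by rewrite /= /store /= 4!updE loadE.
have mm : shifted (base P) (set_cl m1 (upd (cl m1) (base P) (cl m1 0%N))) (start n).
  apply: shifted_start; rewrite ?m1E // => x.
  by rewrite m1E /base; do 5!(case: x => [|x] //); rewrite /= nth_nil.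
rewrite -[RHS](Ex_ret (fst_of ks, ct, Some (i : nat)) (fun s =>
  wp (planted P N n ek b) n (adv_A D) (fun _ => final D n dk) s (start n))).
apply: (sim_run (R := nce_inv n (fst_of ks) ct dk) _ (@nce_inv_local P _ _ _ _) _ _ mm (t := 0)).
- by [].
- by move=> k xs zs q t p' p; apply: nce_ask_sim.
- move=> used' m' d m mm' [[h0 h1 h2 h3 h4] [h5 [o h6 ->]]]; rewrite Ex_ret.
  rewrite wp_call_1 /= h4 (map_shifted _ mm') /final -ExMl; apply: eq_Ex => out.
  by rewrite updE /=; have [_ km bm] := mm'; rewrite /tr /= km bm.
- have low x : (x < 7)%N -> upd (cl m1) (base P) (cl m1 0%N) x = cl m1 x.
    by rewrite updE /base; case: eqP => //; lia.
  rewrite /nce_inv /= !low // !m1E /=.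
  by split=> //; split=> //; exists (Some (i : nat)).
Qed.

Lemma Ex_avg (X : Type) (d : dist X) c w (f : 'I_w -> X -> algC) :
  Ex d (fun x => c * \sum_(i < w) f i x) = c * \sum_(i < w) Ex d (f i).
Proof.
rewrite ExMl /Ex; congr (_ * _); under eq_bigr do rewrite mulr_sumr.
by rewrite exchange_big.
Qed.

Lemma PrE_nc_game P N D e b n g w :
    (forall f, Ex (exec (sampler e) n 1 [::]) f =
      w%:R^-1 * \sum_(i < w) f [:: nseq i true]) ->
  Pr (nc_game N (nce_adv P D e b) n g) (pred1 [:: true]) =
  w%:R^-1 * \sum_(i < w) Ex (ncer_keys N n) (fun k =>
    Ex (exec (ute_gen P) n 1 [:: unary n]) (fun ks =>
    Ex (nc_challenger N n k.1 k.2 g 1 [:: fst_of ks] false) (fun x =>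
      wp (planted P N n k.1 b) n (adv_A D) (fun _ => final D n (snd_of x.2.1))
         ((fst_of ks, fst_of x.2.1), Some (i : nat)) (start n)))).
Proof.
move=> unif; rewrite PrE Ex_bind -Ex_avg; apply: eq_Ex => -[ek dk].
rewrite Ex_bind -(wp_nce_adv _ _ _ _ _ _ _ unif); apply: eq_Ex => -[used out].
by rewrite Ex_ret.
Qed.

(** * Legality of the reduction to non-committing security *)

Lemma Ex_monitor (S : Type) L (O : oracle S) k xs s f :
  Ex (monitor L O k xs s) f =
    Ex (O k xs s.1) (fun x => f ((x.1, s.2 && L xs), x.2)).
Proof. by rewrite Ex_bind; apply: eq_Ex => -[s1 a]; rewrite Ex_ret. Qed.

(** The formal sum of keys may list strings outside [K]; only their total weights vanish, so the
    terms have to be grouped by key. *)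
Lemma Ex_keys0 P K n f : key_space P K -> (forall k, K n k -> f k = 0) ->
  Ex (exec (ute_gen P) n 1 [:: unary n]) (fun ks => f (fst_of ks)) = 0.
Proof.
move=> P_keys f0; pose d := ks <~ exec (ute_gen P) n 1 [:: unary n]; ret (fst_of ks).
have Ed g : Ex d g = Ex (exec (ute_gen P) n 1 [:: unary n]) (fun ks => g (fst_of ks)).
  by rewrite Ex_bind; apply: eq_Ex => ks; rewrite Ex_ret.
rewrite -Ed; apply: (Ex_supp (L := K n)) => // k nKk.
by rewrite PrE Ed -(P_keys n k nKk) PrE.
Qed.

(** Relating a state to the empty mixture says that the expectation to come is 0; the simulation
    principle thereby becomes an invariant rule for the flag of the monitor. *)
Definition safe_inv (S : Type) n (_ : nat) (s : S * bool) (r : regs)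
    (d : dist unit) : Prop := [/\ s.2, r 0%N = unary n & d = [::]].

Lemma nce_ask_safe (S : Type) (O : oracle S) P K n b k xs zs q t p' p :
    key_space P K ->
    sim_post (base P) (@safe_inv S n) t p' p ->
  sim_post (base P) (@safe_inv S n) t.+1
    (wp (monitor (single_message K n) O) n (nce_ask P b k xs zs q) p')
    (wp no_oracle n (Ask k xs zs q) p).
Proof.
move=> P_keys Hp s' m' d m mm [s'_ok r0 ->]; rewrite Ex_nil wp_seq wp_case.
have loc : forall t s' (r r' : regs) d,
    (forall x, (x < base P)%N -> r x = r' x) ->
  @safe_inv S n t s' r d -> @safe_inv S n t s' r' d.
  by move=> t1 s1 r r' d1 rr'; rewrite /safe_inv rr'.
have enc (s1 : S * bool) m1 x y : s1.2 -> cl m1 0%N = unary n -> shifted (base P) m1 m ->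
  wp (monitor (single_message K n) O) n
    (Call (ute_enc P) [:: x; y] None (iota 8 (ute_nct P)) q)
    (wp (monitor (single_message K n) O) n (copies 7 (ute_nct P).+1 (base P) zs) p')
    s1 m1 = 0.
  move=> s1_ok m1_0 mm1; rewrite (sim_encrypt _ _ _ _ _ _ loc Hp (d := [::]) mm1).
    by apply: Ex0 => c; rewrite Ex_nil.
  by move=> ys; split=> //; rewrite store_low.
have fresh m1 x : cl m1 0%N = unary n -> shifted (base P) m1 m ->
  wp (monitor (single_message K n) O) n (nce_fresh P x q)
    (wp (monitor (single_message K n) O) n (copies 7 (ute_nct P).+1 (base P) zs) p')
    s' m1 = 0.
  move=> m1_0 mm1; rewrite wp_seq wp_call_1 /= m1_0.
  pose f sk := wp (monitor (single_message K n) O) n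
    (Ask 0 [:: 5]%N [:: 7]%N None ;; Call (ute_enc P) [:: 5%N; x] None (iota 8 (ute_nct P)) q)
    (wp (monitor (single_message K n) O) n (copies 7 (ute_nct P).+1 (base P) zs) p')
    s' (set_cl m1 (upd (cl m1) 5 sk)).
  apply: (Ex_keys0 (f := f) P_keys) => sk Ksk; rewrite /f wp_seq wp_ask /= updE /=.
  rewrite Ex_monitor; apply: Ex0 => x1; rewrite Ex_putq /=.
  rewrite enc ?mulr0 //=.
  - by rewrite s'_ok /single_message /= Ksk.
  - by rewrite store_out // updE.
  - by have [r_r km bm] := mm1; split=> // z; rewrite /= store_out ?updE ?r_r.
case: (cl m' 1%N) => [|[] c].
- rewrite wp_seq wp_copy wp_seq wp_push.
  by apply: enc => //=; [rewrite !updE | apply: shifted_upd => //; apply: shifted_upd].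
- rewrite wp_seq wp_pop.
  by apply: fresh; [rewrite /= updE | apply: shifted_upd].
- exact: fresh.
Qed.

Lemma nce_adv_legal P K D e b : key_space P K ->
  legal (single_message K) (nce_adv P D e b).
Proof.
move=> P_keys S O s0 n _; have [w [_ unif]] := sampler_uniform e n.
rewrite PrE Ex_exec_adv -/(start n) wp_seq wp_call_1 unif big1 ?mulr0 // => i _.
rewrite wp_seq wp_call_1 /= updE loadE /=.
set r1 := upd _ 1 _; pose rest := Ask 1 [:: 2]%N [:: 3; 4]%N None ;; Copy 0 (base P) ;;
  shift (base P) (nce_ask P b) (adv_A D) ;;
  Call (adv_B D) (4%N :: iota (base P) (adv_nst D)) None [:: 0]%N None.
pose post (s : S * bool) m := tr m * (~~ s.2)%:R.
pose f sk := wp (monitor (single_message K n) O) n rest post (s0, true)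
  (set_cl (start n) (upd r1 2 sk)).
apply: (Ex_keys0 (f := f) P_keys) => sk Ksk; rewrite /f /rest wp_seq wp_ask /= updE /=.
rewrite Ex_monitor; apply: Ex0 => x; rewrite Ex_putq wp_seq wp_copy wp_seq.
set m1 := Mem _ _ _.
have low y : y \notin [:: 1; 2; 3; 4]%N -> cl m1 y = nth [::] [:: unary n] y.
  rewrite !inE !negb_or => /and4P[y1 y2 y3 y4]; rewrite /= store_out ?inE ?negb_or ?y3 //.
  by rewrite updE (negPf y2) updE (negPf y1) loadE.
have mm : shifted (base P) (set_cl m1 (upd (cl m1) (base P) (cl m1 0%N))) (start n).
  apply: shifted_start; rewrite ?low // => y yB.
  rewrite low; last by rewrite !inE; move: yB; rewrite /base; lia.
  by case: y yB => //= y _; rewrite nth_nil.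
rewrite -[RHS](mulr0 (x.2.2.1 == x.2.2.2)%:R); congr (_ * _).
(* The value 0 is presented as an expectation over the empty mixture of runs against a dummy
   oracle. *)
rewrite -(Ex_nil (fun s => wp no_oracle n (adv_A D) (fun _ _ => 0) s (start n))).
apply: (sim_run (R := @safe_inv S n) _ _ _ _ mm (t := 0)).
- by [].
- by move=> t s r r' d rr'; rewrite /safe_inv rr'.
- by move=> k xs zs q t p' p; apply: nce_ask_safe.
- move=> s m' d m mm' [s_ok _ ->]; rewrite Ex_nil wp_call_1.
  by apply: Ex0 => out; rewrite /post s_ok mulr0.
- split=> //; first by rewrite /single_message /= Ksk.
  by transitivity (cl m1 0%N); [exact: updE | rewrite low].
Qed.

(** * The reduction to one-time security *)

Definition clear (xs : seq nat) : cmd := foldr (fun x c => Copy 6 x ;; c) Skip xs.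

Definition ute_ask (P : ute) (N : ncer) (_ : nat) (xs zs : seq nat)
    (q : option nat) : cmd :=
  let ms := map (addn (base P)) xs in
  let encrypt x := Call (hybrid_enc P N) [:: 5%N; x] None (iota 7 (ute_nct P).+1) q in
  Case 1
    (clear (iota 8 (ute_nct P)) ;; Copy 3 7 ;; Push false 1 ;;
     Ask 0 ms (iota 8 (ute_nct P)) q)
    (encrypt (nth 6%N ms 0))
    (Pop 1 ;; encrypt (nth 6%N ms 1)) ;;
  copies 7 (ute_nct P).+1 (base P) zs.

(** The first stage outputs all its registers up to the simulated outputs, and the second one
    receives them after the one-time key, hence moved up by one: its register 5 is the former 4, the
    state of [nce_fake], and the simulated outputs start at [(base P).+1]. *)
Definition ute_red (P : ute) (N : ncer) (D : ute_adv) (e : nat) : ute_adv := UteAdv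
  (Call (sampler e) [::] None [:: 1]%N None ;;
   Call (nce_kg N) [:: 0]%N None [:: 5; 2]%N None ;;
   Call (nce_fake N) [:: 5]%N None [:: 3; 4]%N None ;;
   Copy 0 (base P) ;;
   shift (base P) (ute_ask P N) (adv_A D))
  (Call (nce_reveal N) [:: 5; 0]%N None [:: 0]%N None ;;
   Call (adv_B D) (0%N :: iota (base P).+1 (adv_nst D)) None [:: 0]%N None)
  (base P + adv_nst D).

(* What the adversary sees in the simulation by ute_red. The padding matters
   only for legality, where O may answer with any number of strings. *)
Definition wrapped (P : ute) (N : ncer) (n : nat) (ek ct : bits) (S : Type)
    (O : oracle S) : oracle (S * option nat) :=
  plant (hybrid P N) n ek (fun ms s => '(s1, a) <~ O 0%N ms s;
    ret (s1, (ct :: mkseq (nth [::] a.1) (ute_nct P), a.2))).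

Lemma Ex_wrapped P N n ek ct (S : Type) (O : oracle S) k ms s f :
  Ex (wrapped P N n ek ct O k ms s) f =
    if s.2 is Some 0 then Ex (O 0%N ms s.1) (fun x =>
      f ((x.1, None), (ct :: mkseq (nth [::] x.2.1) (ute_nct P), x.2.2)))
    else Ex (ute_encrypt (hybrid P N) n ek (if s.2 then snd_of ms else fst_of ms))
            (fun c => f ((s.1, omap predn s.2), c)).
Proof.
rewrite Ex_plant; case: s => s [[|i]|] //=; rewrite Ex_bind.
by apply: eq_Ex => -[s1 a]; rewrite Ex_ret.
Qed.

Lemma wp_clear (S : Type) (O : oracle S) n a k p s m :
    (6 < a)%N -> cl m 6%N = [::] ->
  wp O n (clear (iota a k)) p s m =
    p s (set_cl m (store (iota a k) (nseq k [::]) (cl m))).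
Proof.
elim: k a m => [|k IH] a m a6 m6; first by rewrite wp_skip; case: m m6.
have a6' : (6 == a)%N = false by rewrite ltn_eqF.
rewrite wp_seq wp_copy m6 IH; first by [].
  by rewrite ltnW.
by rewrite updE a6'.
Qed.

(** In cleared registers, strings missing from a short answer read as empty, and those beyond [k]
    are dropped. *)
Lemma store_pad (r : regs) a k ys :
    (forall x, (a <= x < a + k)%N -> r x = [::]) ->
  [seq store (iota a k) ys r x | x <- iota a k] = mkseq (nth [::] ys) k.
Proof.
move=> r0; apply: (@eq_from_nth _ [::]); rewrite size_map !size_iota ?size_mkseq // => i i_k.
rewrite (nth_map 0%N) ?size_iota // nth_iota // nth_mkseq // store_iota leq_addr ltn_add2l.
rewrite addKn leq_min i_k /=; case: ltnP => // i_ys.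
by rewrite r0 ?nth_default // leq_addr ltn_add2l.
Qed.

Definition ute_inv (S : Type) (ek ct st : bits) (_ : nat) (s' : S) (r : regs)
    (d : dist (S * option nat)) : Prop :=
  [/\ r 5%N = ek, r 3%N = ct, r 4%N = st & r 6%N = [::]] /\
  exists2 o, r 1%N = counter o & d = ret (s', o).

Lemma ute_inv_local (S : Type) P ek ct st t (s' : S) (r r' : regs) d :
    (forall x, (x < base P)%N -> r x = r' x) ->
  ute_inv ek ct st t s' r d -> ute_inv ek ct st t s' r' d.
Proof. by move=> rr'; rewrite /ute_inv !rr'. Qed.

Lemma ute_encrypt_sim P N n (S : Type) (O : oracle S) ek ct st t x q zs s' d m' m p' p :
    sim_post (base P) (@ute_inv S ek ct st) t p' p -> shifted (base P) m' m ->
    ute_inv ek ct st t s' (cl m') d ->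
  wp O n (Call (hybrid_enc P N) [:: 5%N; x] None (iota 7 (ute_nct P).+1) q)
    (wp O n (copies 7 (ute_nct P).+1 (base P) zs) p') s' m' =
  Ex (ute_encrypt (hybrid P N) n ek (cl m' x)) (fun c => Ex d (fun s =>
    Ex (putq q c.2 (set_cl m (store zs c.1 (cl m)))) (p s))).
Proof.
move=> Hp mm [[h1 h2 h3 h4] [o h5 h6]]; rewrite wp_call_cq size_iota.
have -> : [seq cl m' y | y <- [:: 5%N; x]] = [:: ek; cl m' x] by rewrite /= h1.
apply: (eq_Ex_All (ute_encrypt_size (hybrid P N) n ek (cl m' x))) => c c_nct.
have [r_r km bm] := mm.
apply: (sim_copies _ _ _ _ _ (@ute_inv_local S P ek ct st) _ _ Hp _ _ km bm) => //.
- exact: store_regs.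
- rewrite /ute_inv !(store_iota 7) /=.
  by split=> //; exists o.
- move=> z; rewrite store_iota c_nct minnn -r_r; case: ifP => // /andP[_].
  by rewrite /base /=; lia.
Qed.

Lemma ute_ask_sim P N n (S : Type) (O : oracle S) ek ct st k xs zs q t p' p :
    sim_post (base P) (@ute_inv S ek ct st) t p' p ->
  sim_post (base P) (@ute_inv S ek ct st) t.+1
    (wp O n (ute_ask P N k xs zs q) p')
    (wp (wrapped P N n ek ct O) n (Ask k xs zs q) p).
Proof.
move=> Hp s' m' d m mm inv; have [[h1 h2 h3 h4] [o h5 h6]] := inv.
have msg i := nth_reg xs i mm h4.
rewrite h6 Ex_ret wp_ask Ex_wrapped wp_seq wp_case h5.
case: o h5 h6 inv => [[|j]|] h5 h6 inv /=.
- rewrite wp_seq wp_clear // wp_seq wp_copy wp_seq wp_push wp_ask.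
  set m1 := set_cl _ (upd _ 1 _).
  have m1E x : cl m1 x = if x == 1%N then [:: false] else if x == 7%N then ct else
      if (8 <= x < 8 + ute_nct P)%N then [::] else cl m' x.
    rewrite /= (@store_low _ _ _ 3%N) // h2 updE; case: ifP => _.
      by rewrite updE (@store_low _ _ _ 1%N) //= h5.
    rewrite updE; case: ifP => // _.
    by rewrite store_iota size_nseq minnn nth_nseq if_same.
  have m1B x : cl m1 (base P + x)%N = cl m x.
    have [<- _ _] := mm; rewrite m1E; move: (cl m' _) => v.
    by rewrite /base !ifF //; lia.
  have -> : [seq cl m1 x | x <- map (addn (base P)) xs] = [seq cl m x | x <- xs].
    by rewrite -map_comp; apply: eq_map => x; exact: m1B.
  have [km bm] : kt m1 = kt m /\ br m1 = br m by have [_] := mm.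
  clearbody m1; apply: eq_Ex => x.
  rewrite -[RHS](Ex_ret (x.1, None : option nat) (fun s => Ex (putq q x.2.2
    (set_cl m (store zs (ct :: mkseq (nth [::] x.2.1) (ute_nct P)) (cl m)))) (p s))).
  apply: (sim_copies _ _ _ _ _ (@ute_inv_local S P ek ct st) _ _ Hp _ _ _ _) => //.
  + rewrite [map _ _]/= store_low // m1E; congr (_ :: _).
    apply: store_pad => y y8; rewrite m1E y8.
    by move: y8; case: eqP => [->|_] //; case: eqP => [->|].
  + by rewrite /ute_inv !store_low // !m1E; split=> //; exists None.
  + move=> z; rewrite store_out ?m1B // mem_iota /base; lia.
- rewrite wp_seq wp_pop; set m1 := set_cl _ _.
  have mm1 : shifted (base P) m1 m by apply: shifted_upd.
  have inv1 : ute_inv ek ct st t s' (cl m1) (ret (s', Some j)).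
    by rewrite /ute_inv !updE h5 /=; split=> //; exists (Some j).
  rewrite (ute_encrypt_sim _ _ _ _ _ _ Hp mm1 inv1) [cl m1 _]updE.
  have -> : (nth 6%N (map (addn (base P)) xs) 1 == 1%N) = false.
    by move: (nth_msg (base P) xs 1); move: (nth _ _ _) => v; rewrite /base; lia.
  by rewrite msg; apply: eq_Ex => c; rewrite Ex_ret.
- rewrite (ute_encrypt_sim _ _ _ _ _ _ Hp mm inv) msg h6.
  by apply: eq_Ex => c; rewrite Ex_ret.
Qed.

Lemma Ex_ncer_keys N n f :
  Ex (ncer_keys N n) f =
    Ex (exec (nce_kg N) n 2 [:: unary n]) (fun ks => f (fst_of ks, snd_of ks)).
Proof. by rewrite Ex_bind; apply: eq_Ex => ks; rewrite Ex_ret. Qed.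

Lemma Ex_ncer_fake N n ek f :
  Ex (ncer_fake N n ek) f =
    Ex (exec (nce_fake N) n 2 [:: ek]) (fun xs => f (fst_of xs, snd_of xs)).
Proof. by rewrite Ex_bind; apply: eq_Ex => xs; rewrite Ex_ret. Qed.

Lemma Ex_ncer_reveal N n st m f :
  Ex (ncer_reveal N n st m) f =
    Ex (exec (nce_reveal N) n 1 [:: st; m]) (fun xs => f (fst_of xs)).
Proof. by rewrite Ex_bind; apply: eq_Ex => xs; rewrite Ex_ret. Qed.

Lemma Ex_single_key P n f :
  Ex (single_key P n) f =
    Ex (exec (ute_gen P) n 1 [:: unary n]) (fun ks => f (fst_of ks, fst_of ks)).
Proof. by rewrite Ex_bind; apply: eq_Ex => ks; rewrite Ex_ret. Qed.

(** [O] is arbitrary because this serves both the game and legality. [p] depends on the content of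
    register 4, the state of [nce_fake], which the second stage will use. *)
Lemma wp_ute_red P N D e n (S : Type) (O : oracle S) s0 w
    (p' : S -> mem -> algC) (p : bits -> S -> mem -> algC) :
    (forall f, Ex (exec (sampler e) n 1 [::]) f =
      w%:R^-1 * \sum_(i < w) f [:: nseq i true]) ->
    (forall s m' m, shifted (base P) m' m -> p' s m' = p (cl m' 4%N) s m) ->
  wp O n (adv_A (ute_red P N D e)) p' s0 (start n) =
  w%:R^-1 * \sum_(i < w) Ex (ncer_keys N n) (fun k =>
    Ex (ncer_fake N n k.1) (fun x =>
      wp (wrapped P N n k.1 x.1 O) n (adv_A D) (fun s => p x.2 s.1)
         (s0, Some (i : nat)) (start n))).
Proof.
move=> unif p'E; rewrite /= wp_seq wp_call_1 unif; congr (_ * _).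
apply: eq_bigr => i _; rewrite wp_seq wp_call_2 Ex_ncer_keys /= updE loadE /=.
apply: eq_Ex => ks; rewrite wp_seq wp_call_2 Ex_ncer_fake /= !updE /=.
apply: eq_Ex => xs; rewrite wp_seq wp_copy; set m1 := set_cl _ (upd (upd _ 3 _) 4 _).
have m1E x : cl m1 x = if x == 4%N then snd_of xs else if x == 3%N then fst_of xs else
    if x == 2%N then snd_of ks else if x == 5%N then fst_of ks else
    if x == 1%N then nseq i true else nth [::] [:: unary n] x.
  by rewrite /= 5!updE loadE.
have mm : shifted (base P) (set_cl m1 (upd (cl m1) (base P) (cl m1 0%N))) (start n).
  apply: shifted_start; rewrite ?m1E // => x.
  by rewrite m1E /base; do 6!(case: x => [|x] //); rewrite /= nth_nil.
rewrite -[RHS](Ex_ret (s0, Some (i : nat)) (fun s =>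
  wp (wrapped P N n (fst_of ks) (fst_of xs) O) n (adv_A D)
    (fun s => p (snd_of xs) s.1) s (start n))).
apply: (sim_run (R := @ute_inv S (fst_of ks) (fst_of xs) (snd_of xs)) _
  (@ute_inv_local S P _ _ _) _ _ mm (t := 0)).
- by [].
- by move=> k ys zs q t q' q0; apply: ute_ask_sim.
- move=> s m' d m mm' [[h1 h2 h3 h4] [o h5 ->]].
  by rewrite Ex_ret (p'E _ _ _ mm') h3.
- have low x : (x < 7)%N -> upd (cl m1) (base P) (cl m1 0%N) x = cl m1 x.
    by rewrite updE /base; case: eqP => //; lia.
  rewrite /ute_inv /= !low // !m1E /=.
  by split=> //; exists (Some (i : nat)).
Qed.

(** The limit of one query does no harm: the challenger is asked at the planted query only, and its
    counter is 0 up to then. *)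
Lemma wp_wrapped_challenger P N n ek ct sk b A p i m :
  wp (wrapped P N n ek ct (ute_challenger P (Some 1%N) n sk b)) n A (fun _ => p)
     (0%N, Some i) m =
  wp (planted P N n ek b) n A (fun _ => p) ((sk, ct), Some i) m.
Proof.
pose R (_ : nat) (s : nat * option nat) d :=
  d = ret ((sk, ct), s.2) /\ (s.2 -> s.1 = 0%N).
rewrite -[RHS](Ex_ret (sk, ct, Some i) (fun s => wp (planted P N n ek b) n A (fun _ => p) s m)).
apply: (@sim_oracle _ _ _ _ n R _ _ A 0) => //.
- move=> k xs t [j o] d f' f [/= -> o_j] ff; rewrite Ex_ret Ex_wrapped Ex_plant /=.
  case: o o_j ff => [[|o]|] o_j ff /=.
  + rewrite o_j // Ex_challenger // [RHS]Ex_bind.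
    apply: (eq_Ex_All (ute_encrypt_size _ _ _ _)) => c c_nct.
    rewrite Ex_ret /= -c_nct mkseq_nth.
    by rewrite (ff _ (ret (sk, ct, None))) ?Ex_ret.
  + apply: eq_Ex => c; rewrite (ff _ (ret (sk, ct, Some o))) ?Ex_ret //.
  + by apply: eq_Ex => c; rewrite (ff _ (ret (sk, ct, None))) ?Ex_ret.
- by move=> s1 d1 m1 [-> _]; rewrite Ex_ret.
Qed.

Lemma PrE_ute_red P N D e b n w :
    (forall f, Ex (exec (sampler e) n 1 [::]) f =
      w%:R^-1 * \sum_(i < w) f [:: nseq i true]) ->
  Pr (ute_game single_key P (Some 1%N) (ute_red P N D e) n b) (pred1 [:: true]) =
  w%:R^-1 * \sum_(i < w) Ex (ncer_keys N n) (fun k =>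
    Ex (exec (ute_gen P) n 1 [:: unary n]) (fun ks =>
    Ex (ncer_fake N n k.1) (fun x => Ex (ncer_reveal N n x.2 (fst_of ks)) (fun dk =>
      wp (planted P N n k.1 b) n (adv_A D) (fun _ => final D n dk)
         ((fst_of ks, x.1), Some (i : nat)) (start n))))).
Proof.
move=> unif; rewrite PrE Ex_bind Ex_single_key.
transitivity (Ex (exec (ute_gen P) n 1 [:: unary n]) (fun ks =>
  w%:R^-1 * \sum_(i < w) Ex (ncer_keys N n) (fun k =>
    Ex (ncer_fake N n k.1) (fun x => Ex (ncer_reveal N n x.2 (fst_of ks)) (fun dk =>
      wp (planted P N n k.1 b) n (adv_A D) (fun _ => final D n dk)
         ((fst_of ks, x.1), Some (i : nat)) (start n)))))); last first.
  rewrite Ex_avg; congr (_ * _); apply: eq_bigr => i _; exact: Ex_swap.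
apply: eq_Ex => ks; rewrite Ex_bind.
pose g (x : nat * seq bits) := Ex (exec (adv_B (ute_red P N D e)) n 1 (fst_of ks :: x.2))
  (fun out => (fst_of out == [:: true])%:R).
transitivity (Ex (exec_adv (ute_challenger P (Some 1%N) n (fst_of ks) b) 0%N
  (adv_A (ute_red P N D e)) n (adv_nst (ute_red P N D e))) g).
  by apply: eq_Ex => -[i st]; rewrite Ex_bind; apply: eq_Ex => out; rewrite Ex_ret.
rewrite Ex_exec_adv -/(start n).
pose p st (s : nat) m := Ex (ncer_reveal N n st (fst_of ks)) (fun dk => final D n dk m).
rewrite (wp_ute_red (p := p) _ _ _ _ unif).
  congr (_ * _); apply: eq_bigr => i _; apply: eq_Ex => k; apply: eq_Ex => x.
  (* [nce_reveal] runs after the first stage here and before it in the non-committing game; its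
     inputs do not depend on that run, so the expectations are exchanged. *)
  by rewrite wp_wrapped_challenger [RHS]Ex_swap.
move=> s m' m mm; have [r_r km bm] := mm.
rewrite /p /final ExMl /tr km bm; congr (_ * _).
set st := map _ _.
have stE x : (x < base P + adv_nst D)%N -> load (fst_of ks :: st) x.+1 = cl m' x.
  by move=> xB; rewrite loadE /= (nth_map 0%N) ?size_iota // nth_iota.
rewrite /g Ex_exec wp_seq wp_call_1 Ex_ncer_reveal /= stE; last by rewrite /base; lia.
rewrite [load _ 0%N]loadE; apply: eq_Ex => ys.
rewrite wp_call_1 /= updE eqxx.
have -> : [seq upd (load (fst_of ks :: st)) 0 (fst_of ys) x | x <- iota (base P).+1 (adv_nst D)]
    = [seq cl m x | x <- iota 0 (adv_nst D)].
  rewrite -(map_shifted _ mm) -addn1 addnC iotaDl -map_comp.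
  apply/eq_in_map => x; rewrite mem_iota => /andP[_ xB].
  by rewrite /= updE stE.
by apply: eq_Ex => out; rewrite /tr eqxx mul1r /= updE.
Qed.

(* Whether the query answered by the challenge is legal is detected by the
   difference between the runs where it is answered in any case (s.1 = true) and
   those which are dropped if it is not legal (s.1 = false). *)
Definition detector (P : ute) (N : ncer) (n : nat) (ek ct : bits) (L : pred (seq bits))
    (S : Type) (O : oracle S) : oracle (bool * (S * option nat)) := fun k ms s =>
  if [&& ~~ s.1, s.2.2 == Some 0%N & ~~ L ms] then [::]
  else '(s1, a) <~ wrapped P N n ek ct O k ms s.2; ret ((s.1, s1), a).

Lemma detector_wf P N n ek ct L (S : Type) (O : oracle S) :
  well_formed O -> well_formed (detector P N n ek ct L O).
Proof.
move=> /well_formedE O_wf; apply/well_formedE => k ms [b [s o]].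
have enc_wf m : All (fun c => size c.2.1 = size c.2.2) (ute_encrypt (hybrid P N) n ek m).
  exact: qexec_balanced.
rewrite /detector; case: ifP => // _.
apply: (@All_bind _ _ (fun x => size x.2.2.1 = size x.2.2.2)) => [|[s1 a] /= aa //].
rewrite /wrapped /plant /=; case: o => [[|o]|].
- apply: (@All_bind _ _ (fun x => size x.2.2.1 = size x.2.2.2)) => [|[s1 a] /= aa //].
  by apply: All_bind (O_wf _ _ _) _ => -[s1 a] /= aa.
- by apply: All_bind (enc_wf _) _ => c cc.
- by apply: All_bind (enc_wf _) _ => c cc.
Qed.

Lemma Ex_detector P N n ek ct L (S : Type) (O : oracle S) k ms s f :
  Ex (detector P N n ek ct L O k ms s) f =
    if [&& ~~ s.1, s.2.2 == Some 0%N & ~~ L ms] then 0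
    else Ex (wrapped P N n ek ct O k ms s.2) (fun x => f ((s.1, x.1), x.2)).
Proof.
rewrite /detector; case: ifP => _; first exact: Ex_nil.
by rewrite Ex_bind; apply: eq_Ex => -[s1 a]; rewrite Ex_ret.
Qed.

(** If the planted query is legal, both terms count the run alike, whatever other queries were
    illegal; otherwise the second term drops it and the first counts it. Bounding the left-hand side
    by the weight of all runs with an illegal query would require positive weights. *)
Lemma wp_detector P N n ek ct L (S : Type) (O : oracle S) A s0 i m :
  let loss b := wp (monitor L (detector P N n ek ct L O)) n A
    (fun s m => tr m * (~~ s.2)%:R) ((b, (s0, Some i)), true) m in
  wp (wrapped P N n ek ct (monitor L O)) n A (fun s m => tr m * (~~ s.1.2)%:R)
     ((s0, true), Some i) m = loss true - loss false.
Proof.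
pose pair (g : bool) (x : S * option nat) : dist (bool * (S * option nat) * bool) :=
  [:: (1, ((true, x), g)); (-1, ((false, x), g))].
have Ex_pair g x f : Ex (pair g x) f = f ((true, x), g) - f ((false, x), g).
  by rewrite !Ex_cons Ex_nil mul1r mulN1r addr0.
pose R (_ : nat) (s : S * bool * option nat) d :=
  if s.1.2 then exists g, d = pair g (s.1.1, s.2)
  else s.2 = None /\ d = ret ((true, (s.1.1, None)), false).
rewrite /= -(Ex_pair true (s0, Some i) (fun s => wp (monitor L (detector P N n ek ct L O)) n A
  (fun s m => tr m * (~~ s.2)%:R) s m)).
apply: (@sim_oracle _ _ _ _ n R _ _ A 0) => //.
- move=> k ms t [[s f0] o] d f' f; rewrite /R /= => Rd ff; rewrite Ex_wrapped /=.
  case: f0 Rd => [[g ->]|[-> ->]].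
    rewrite Ex_pair !Ex_monitor !Ex_detector /= !Ex_wrapped /=.
    case: o => [[|o]|] /=.
    + case: ifPn => Lms.
        rewrite subr0; apply: eq_Ex => x; rewrite (negPf Lms) andbF.
        by rewrite (ff _ (ret ((true, (x.1, None)), false))) ?Ex_ret.
      rewrite -ExB; apply: eq_Ex => x; rewrite (negbNE Lms) andbT.
      by rewrite (ff _ (pair g (x.1, None))) ?Ex_pair //; exists g.
    + rewrite -ExB; apply: eq_Ex => c.
      by rewrite (ff _ (pair (g && L ms) (s, Some o))) ?Ex_pair //; exists (g && L ms).
    + rewrite -ExB; apply: eq_Ex => c.
      by rewrite (ff _ (pair (g && L ms) (s, None))) ?Ex_pair //; exists (g && L ms).
  rewrite Ex_ret Ex_monitor Ex_detector /= Ex_wrapped /=; apply: eq_Ex => c.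
  by rewrite (ff _ (ret ((true, (s, None)), false))) ?Ex_ret.
- by exists true.
- move=> [[s f0] o] d m1; rewrite /R /=; case: f0 => [[g ->]|[_ ->]].
    by rewrite Ex_pair mulr0 subrr.
  by rewrite Ex_ret.
Qed.

Lemma ute_red_legal M P N D e : legal (message_pair M) (adv_A D) ->
  legal (message_pair M) (adv_A (ute_red P N D e)).
Proof.
move=> D_legal S O s0 n O_wf; have [w [_ unif]] := sampler_uniform e n.
rewrite PrE Ex_exec_adv -/(start n).
rewrite (wp_ute_red (p := fun _ s m => tr m * (~~ s.2)%:R) _ _ _ _ unif).
  rewrite big1 ?mulr0 // => i _; apply: Ex0 => k; apply: Ex0 => x.
  have no_loss b : wp (monitor (message_pair M n) (detector P N n k.1 x.1 (message_pair M n) O))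
      n (adv_A D) (fun s m => tr m * (~~ s.2)%:R) ((b, (s0, Some (i : nat))), true) (start n) = 0.
    have := D_legal _ _ (b, (s0, Some (i : nat))) n
      (detector_wf P N n k.1 x.1 (message_pair M n) O_wf).
    by rewrite PrE Ex_exec_adv.
  by rewrite wp_detector !no_loss subrr.
by move=> s m' m [_ km bm]; rewrite /tr km bm.
Qed.

(** * The hybrid argument *)

Definition hybrid_value P N D n i : algC :=
  Ex (ncer_keys N n) (fun k =>
    wp (threshold (hybrid P N) n k.1) n (adv_A D) (fun _ => final D n k.2) i (start n)).

Lemma PrE_collusion_game P N D n b :
  Pr (ute_game separate_keys (hybrid P N) None D n b) (pred1 [:: true]) =
  Ex (ncer_keys N n) (fun k =>
    wp (ute_challenger (hybrid P N) None n k.1 b) n (adv_A D) (fun _ => final D n k.2)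
       0%N (start n)).
Proof.
rewrite PrE Ex_bind; apply: eq_Ex => -[ek dk] /=; rewrite Ex_bind.
rewrite /final -(Ex_exec_adv _ _ _ _ _ (fun x => Ex (exec (adv_B D) n 1 (dk :: x.2))
  (fun out => (fst_of out == [:: true])%:R))).
by apply: eq_Ex => -[i st]; rewrite Ex_bind; apply: eq_Ex => out; rewrite Ex_ret.
Qed.

Lemma PrE_nc_real P N D e (b : bool) n w :
    (forall f, Ex (exec (sampler e) n 1 [::]) f =
      w%:R^-1 * \sum_(i < w) f [:: nseq i true]) ->
  Pr (nc_game N (nce_adv P D e b) n false) (pred1 [:: true]) =
  w%:R^-1 * \sum_(i < w) hybrid_value P N D n (i + b).
Proof.
move=> unif; rewrite (PrE_nc_game _ _ _ _ _ unif); congr (_ * _).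
apply: eq_bigr => i _; apply: eq_Ex => k; rewrite wp_planted.
by apply: eq_Ex => ks; rewrite Ex_bind; apply: eq_Ex => ct; rewrite Ex_ret.
Qed.

Lemma PrE_nc_fake P N D e (b : bool) n :
  Pr (nc_game N (nce_adv P D e b) n true) (pred1 [:: true]) =
  Pr (ute_game single_key P (Some 1%N) (ute_red P N D e) n b) (pred1 [:: true]).
Proof.
have [w [_ unif]] := sampler_uniform e n.
rewrite (PrE_nc_game _ _ _ _ _ unif) (PrE_ute_red _ _ _ _ unif); congr (_ * _).
apply: eq_bigr => i _; apply: eq_Ex => k; apply: eq_Ex => ks.
rewrite Ex_bind; apply: eq_Ex => -[ct st]; rewrite Ex_bind; apply: eq_Ex => dk.
by rewrite Ex_ret.
Qed.

Lemma advantage_bound P N D e n : (asks n (adv_A D) <= n ^ e)%N ->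
  advantage (ute_game separate_keys (hybrid P N) None D) n <=
  ((n ^ e).*2.+1)%:R *
    (advantage (nc_game N (nce_adv P D e false)) n +
     advantage (ute_game single_key P (Some 1%N) (ute_red P N D e)) n +
     advantage (nc_game N (nce_adv P D e true)) n).
Proof.
move=> asks_e; have [w [/andP[w_gt w_le] unif]] := sampler_uniform e n.
have w_neq0 : w%:R != 0 :> algC by rewrite pnatr_eq0; lia.
pose h := hybrid_value P N D n.
pose u b := Pr (ute_game single_key P (Some 1%N) (ute_red P N D e) n b) (pred1 [:: true]).
have advN b : advantage (nc_game N (nce_adv P D e b)) n =
    `| w%:R^-1 * (\sum_(i < w) h (i + b)%N) - u b |.
  congr (`| _ - _ |); [exact: PrE_nc_real | exact: PrE_nc_fake].
have -> : advantage (ute_game separate_keys (hybrid P N) None D) n = `| h 0%N - h w |.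
  congr (`| _ - _ |); rewrite PrE_collusion_game; apply: eq_Ex => k.
    exact: wp_threshold0.
  by apply: wp_threshold; apply: leq_trans asks_e (ltnW w_gt).
rewrite !advN -[advantage _ n]/(`| u false - u true |) {advN}.
clearbody h u.
(* The averages of [h i] and [h i.+1] over [i < w] differ by [(h 0 - h w) / w]; the values [u] of
   the faked games are inserted between them. *)
have -> : h 0%N - h w = w%:R * (w%:R^-1 * (\sum_(i < w) h (i + false)%N) - u false +
    (u false - u true) - (w%:R^-1 * (\sum_(i < w) h (i + true)%N) - u true)).
  rewrite addrA subrK opprB addrA subrK -mulrBr mulrA mulfV // mul1r -sumrB.
  rewrite -[LHS]opprB -(telescope_sumr h (leq0n w)) big_mkord -sumrN.
  by apply: eq_bigr => i _; rewrite opprB addn0 addn1.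
rewrite normrM normr_nat; apply: ler_pM => //; first by rewrite ler_nat.
rewrite (le_trans (ler_normB _ _)) // lerD2r (le_trans (ler_normD _ _)) //.
Qed.

(** * Closure properties of negligible functions *)

Lemma negligible_poly (f g : nat -> algC) e :
    negligible g -> (forall n, (1 < n)%N -> `|f n| <= ((n ^ e).*2.+1)%:R * `|g n|) ->
  negligible f.
Proof.
(* Two extra powers of n absorb the constants: 2 n^e + 1 <= 4 n^e <= n^(e+2) for n >= 2. *)
move=> g_negl fg c; have [n0 g_n0] := g_negl (c + e.+2)%N.
exists (maxn n0 2) => n; rewrite geq_max => /andP[/g_n0 gn n2].
apply: le_lt_trans (fg n n2) _.
have n_gt0 : 0 < n%:R :> algC by rewrite ltr0n; lia.
apply: lt_le_trans (_ : ((n ^ e).*2.+1)%:R * (n%:R ^+ (c + e.+2))^-1 <= _).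
  by rewrite ltr_pM2l // ltr0n.
rewrite exprD invfM mulrCA ger_pMr ?invr_gt0 ?exprn_gt0 //.
rewrite ler_pdivrMr ?exprn_gt0 // mul1r -natrX ler_nat !expnS.
have : (0 < n ^ e)%N by rewrite expn_gt0; lia.
move: (n ^ e)%N => x x_gt0; rewrite mulnA (@leq_trans (4 * x)) //; first by lia.
by rewrite leq_mul2r (leq_mul n2 n2) orbT.
Qed.

Lemma negligibleD (f g : nat -> algC) :
  negligible f -> negligible g -> negligible (fun n => `|f n| + `|g n|).
Proof.
move=> f_negl g_negl c; have [nf Hf] := f_negl c.+1; have [ng Hg] := g_negl c.+1.
exists (maxn 2 (maxn nf ng)) => n; rewrite !geq_max => /and3P[n2 /Hf fn /Hg gn].
rewrite ger0_norm ?addr_ge0 //; apply: lt_le_trans (ltrD fn gn) _.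
have n_gt0 : 0 < n%:R :> algC by rewrite ltr0n; lia.
rewrite exprS invfM -mulrDl ger_pMl ?invr_gt0 ?exprn_gt0 //.
by rewrite -mulr2n -[_ *+ 2]mulr_natl ler_pdivrMr // mul1r ler_nat.
Qed.

Theorem theorem3p17 (M K : nat -> pred bits) (P : ute) (N : ncer)
    (P_correct : ute_correct single_key P M) (P_keys : key_space P K)
    (N_correct : ncer_correct N K)
    (P_secure : ind_secure single_key P M) (N_secure : nc_secure N K) :
  collusion_secure separate_keys (hybrid P N) M.
Proof.
move=> D D_legal; have [e asks_e] := asks_poly (adv_A D).
have N0 := N_secure _ (nce_adv_legal D e false P_keys).
have N1 := N_secure _ (nce_adv_legal D e true P_keys).
have U := P_secure _ (ute_red_legal P N e D_legal).
apply: negligible_poly (negligibleD (negligibleD N0 U) N1) _ => n n2.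
have adv_norm game : `|advantage game n| = advantage game n by exact: normr_id.
rewrite !adv_norm !ger0_norm ?addr_ge0 ?normr_ge0 //.
exact/advantage_bound/asks_e.
Qed.
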